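(* Let $\Omega\subset\mathbb{R}^N$ be a bounded domain with smooth boundary and let $\mu\in\mathfrak{M}^b_+(\Omega)$ be a (bounded) good measure. Then $\mu(E)=0$ for every Borel set $E\subset\Omega$ with zero $C_{\Delta^{L\ln L}}$-capacity.
   Context: $\mathfrak{M}^b_+(\Omega)$ is the set of nonnegative bounded Radon measures on $\Omega$. A measure $\mu\in\mathfrak{M}^b_+(\Omega)$ is called good if the problem $-\Delta u+e^u-1=\mu$ in $\Omega$, $u=0$ on $\partial\Omega$, admits a weak solution, i.e. a function $u\in L^1(\Omega)$ with $e^u\in L^1(\Omega)$ such that $$\int_\Omega\left(-u\Delta\zeta+(e^u-1)\zeta\right)dx=\int_\Omega\zeta\,d\mu\qquad\text{for all }\zeta\in W^{1,\infty}_0(\Omega)\cap W^{2,\infty}(\Omega).$$ Capacity. Let $P^*(t)=(|t|+1)\ln(|t|+1)-|t|$ and $\|\phi\|_{L_{P^*}}=\inf\{k>0:\int_\Omega P^*(\phi/k)\,dx\le1\}$ for measurable $\phi$ on $\Omega$. For compact $K\subset\Omega$, $$C_{\Delta^{L\ln L}}(K)=\inf\left\{\|\Delta\eta\|_{L_{P^*}}:\eta\in C^2_c(\Omega),\ 0\le\eta\le1,\ \eta=1\text{ in a neighborhood of }K\right\}.$$ (Up to equivalence, $\|\Delta\eta\|_{L_{P^*}}$ may be replaced by the $L^1$ norm of the Hardy–Littlewood maximal function of $\Delta\eta$.) A Borel set $E\subset\Omega$ has zero capacity if $C_{\Delta^{L\ln L}}(K)=0$ for every compact $K\subset E$. *)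

(* Defs.v *)
From HB Require Import structures.
From mathcomp Require Import all_boot all_order all_algebra.
From mathcomp Require Import all_classical all_reals all_analysis.
From mathcomp Require Import measurable_realfun.

Set Implicit Arguments.
Unset Strict Implicit.
Unset Printing Implicit Defensive.

Import Order.TTheory GRing.Theory Num.Theory.
Import numFieldNormedType.Exports.

Local Open Scope classical_set_scope.
Local Open Scope ring_scope.

Definition mx_borel_display : measure_display.
Proof. exact: default_measure_display. Qed.

HB.instance Definition _ (R : realType) (m n : nat) :=
  @isMeasurable.Build mx_borel_display 'M[R]_(m, n)
    <<s @open 'M[R]_(m, n) >> (@sigma_algebra0 _ setT open)
    (@sigma_algebraC _ open) (@sigma_algebra_bigcup _ setT open).

Section borel_rV.
Context {R : realType}.

Lemma open_measurable_rV n (A : set 'rV[R]_n) : open A -> measurable A.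
Proof. exact: sub_sigma_algebra. Qed.

Lemma measurable_coord n (i : 'I_n) :
  measurable_fun [set: 'rV[R]_n] (fun x => x ord0 i).
Proof.
apply: (measurability _ (RGenOpens.measurableE R)) => _ [_ [a [b ->]] <-].
rewrite setTI; apply: open_measurable_rV.
apply: open_comp; last exact: interval_open.
by move=> x _; exact: coord_continuous.
Qed.

Lemma measurable_fun_rV d (T : measurableType d) n (f : T -> 'rV[R]_n) :
  (forall i, measurable_fun [set: T] (fun t => f t ord0 i)) ->
  measurable_fun [set: T] f.
Proof.
move=> mf; apply: (@measurability _ _ _ _ _ _ (@open 'rV[R]_n)) => // _ [A oA <-].
rewrite setTI.
pose B (p : 'rV[rat]_n * rat) : set 'rV[R]_n :=
  ball (map_mx ratr p.1 : 'rV[R]_n) (ratr p.2 : R).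
pose F p := if `[< B p `<=` A >] then B p else set0.
have -> : A = \bigcup_p F p.
  apply/seteqP; split => [x Ax|x [p _]]; last first.
    by rewrite /F; case: asboolP => // BA /BA.
  have /nbhs_ballP[e /= e0 xeA] : nbhs x A by exact: open_nbhs_nbhs.
  have /rat_in_itvoo[r] : 0 < e / 2 by rewrite divr_gt0.
  rewrite in_itv/= => /andP[r0 re].
  have q_ i : {q : rat | `|ratr q - x ord0 i| < ratr r}.
    apply: cid.
    have /rat_in_itvoo[q] : x ord0 i - ratr r < x ord0 i + ratr r.
      by rewrite ltrD2l (lt_trans _ r0)// oppr_lt0.
    by rewrite in_itv/= => qx; exists q; rewrite ltr_distl.
  have Bx : B (\row_i sval (q_ i), r) x.
    split => // i j; rewrite !mxE (ord1 i) /ball/=.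
    exact: (svalP (q_ j)).
  exists (\row_i sval (q_ i), r) => //; rewrite /F asboolT// => y By.
  apply: xeA => /=; rewrite [e]splitr.
  pose c : 'rV[R]_n := map_mx ratr (\row_i sval (q_ i)).
  apply: (@ball_triangle R _ c).
    by apply: ball_sym; apply: le_ball Bx; exact/ltW.
  by apply: le_ball By; exact/ltW.
rewrite preimage_bigcup; apply: countable_bigcupT_measurable => // p.
rewrite /F; case: asboolP => _; last by rewrite preimage_set0.
have [p0|p0] := ltP 0 (ratr p.2 : R); last first.
  rewrite (_ : _ @^-1` _ = set0)//; apply/seteqP; split => // t [+ _].
  by rewrite ltNge p0.
have -> : f @^-1` B p = \bigcap_(i in [set: 'I_n])
    ((fun t => f t ord0 i) @^-1` ball (ratr (p.1 ord0 i) : R) (ratr p.2)).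
  apply/seteqP; split => [t [_ Bt] i _|t Bt]; first by have := Bt ord0 i; rewrite mxE.
  by split => // i j; rewrite mxE !ord1; exact: Bt.
apply: fin_bigcap_measurable => // i _.
rewrite -[X in measurable X]setTI; apply: mf => //.
exact: measurable_ball.
Qed.

End borel_rV.

Section lebesgue_step.
Context {R : realType} (n : nat).
Variable m : {sigma_finite_measure set 'rV[R]_n -> \bar R}.

Definition rV_cons (p : measurableTypeR R * 'rV[R]_n) : 'rV[R]_n.+1 :=
  row_mx (const_mx p.1 : 'rV_1) p.2.

Definition rV_uncons (v : 'rV[R]_n.+1) : measurableTypeR R * 'rV[R]_n :=
  (v ord0 ord0, \row_i v ord0 (lift ord0 i)).

Let ord0_lshift : ord0 = lshift n (ord0 : 'I_1) :> 'I_(1 + n).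
Proof. exact/val_inj. Qed.

Let lift_rshift (i : 'I_n) : lift ord0 i = rshift 1 i :> 'I_(1 + n).
Proof. exact/val_inj. Qed.

Lemma rV_cons0 p : rV_cons p ord0 ord0 = p.1.
Proof. by rewrite /rV_cons ord0_lshift [LHS]row_mxEl mxE. Qed.

Lemma rV_consS p i : rV_cons p ord0 (lift ord0 i) = p.2 ord0 i.
Proof. by rewrite /rV_cons lift_rshift [LHS]row_mxEr. Qed.

Lemma rV_consK : cancel rV_cons rV_uncons.
Proof.
move=> [a v]; rewrite /rV_uncons rV_cons0; congr pair.
by apply/rowP => i; rewrite mxE rV_consS.
Qed.

Lemma measurable_rV_cons : measurable_fun [set: _] rV_cons.
Proof.
apply: measurable_fun_rV => i; case: (unliftP ord0 i) => [j|] ->.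
  under eq_fun do rewrite rV_consS.
  apply: (@measurableT_comp _ _ _ _ _ _ (fun x : 'rV[R]_n => x ord0 j)) => //.
  exact: measurable_coord.
under eq_fun do rewrite rV_cons0.
exact: measurable_fst.
Qed.

Lemma measurable_rV_uncons : measurable_fun [set: _] rV_uncons.
Proof.
apply/(measurable_fun_pair (T1 := measurableTypeR R)); first exact: measurable_coord.
apply: measurable_fun_rV => i.
under eq_fun do rewrite /rV_uncons/= mxE.
exact: measurable_coord.
Qed.

Definition lebesgue_rVS : set 'rV[R]_n.+1 -> \bar R :=
  pushforward (lebesgue_measure \x m)%E rV_cons.

Let measurable_pre A : measurable A -> measurable (rV_cons @^-1` A).
Proof.
by move=> mA; rewrite -[X in measurable X]setTI; exact: measurable_rV_cons.
Qed.

Let lebesgue_rVS0 : lebesgue_rVS set0 = 0%E.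
Proof. by rewrite /lebesgue_rVS /pushforward preimage_set0 measure0. Qed.

Let lebesgue_rVS_ge0 A : (0 <= lebesgue_rVS A)%E.
Proof. exact: (measure_ge0 (lebesgue_measure \x m)%E). Qed.

Let lebesgue_rVS_sigma_additive : semi_sigma_additive lebesgue_rVS.
Proof.
move=> F mF tF mUF; rewrite /lebesgue_rVS /pushforward preimage_bigcup.
apply: measure_semi_sigma_additive.
- by move=> i; exact: measurable_pre.
- apply/trivIsetP => /= i j _ _ ij; rewrite -preimage_setI.
  by move/trivIsetP : tF => /(_ _ _ _ _ ij) ->//; rewrite preimage_set0.
- by rewrite -preimage_bigcup; exact: measurable_pre.
Qed.

HB.instance Definition _ := isMeasure.Build _ _ _ lebesgue_rVS
  lebesgue_rVS0 lebesgue_rVS_ge0 lebesgue_rVS_sigma_additive.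

Lemma lebesgue_rVS_sigma_finite : sigma_finite setT lebesgue_rVS.
Proof.
have /sigma_finiteP[F [FT ndF Foo]] := sigma_finiteT (@lebesgue_measure R).
have /sigma_finiteP[G [GT ndG Goo]] := sigma_finiteT m.
exists (fun k => rV_uncons @^-1` (F k `*` G k)).
  rewrite -preimage_bigcup; apply/esym/seteqP; split => // v _.
  have [i _ Fi] : (\bigcup_k F k) (rV_uncons v).1 by rewrite -FT.
  have [j _ Gj] : (\bigcup_k G k) (rV_uncons v).2 by rewrite -GT.
  exists (maxn i j) => //; split.
  - by move: Fi; exact/subsetPset/ndF/leq_maxl.
  - by move: Gj; exact/subsetPset/ndG/leq_maxr.
move=> k; have [mF Fk] := Foo k; have [mG Gk] := Goo k; split.
  rewrite -[X in measurable X]setTI; apply: measurable_rV_uncons => //.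
  exact: measurableX.
rewrite /lebesgue_rVS /pushforward -comp_preimage.
rewrite (_ : rV_uncons \o rV_cons = id); last exact/funext/rV_consK.
by rewrite preimage_id product_measure1E// lte_mul_pinfty// ge0_fin_numE.
Qed.

HB.instance Definition _ :=
  Measure_isSigmaFinite.Build _ _ _ lebesgue_rVS lebesgue_rVS_sigma_finite.

End lebesgue_step.

(* The n-fold product of the Lebesgue measure on R: see lebesgue_rV_prod. *)
Fixpoint lebesgue_rV (R : realType) (n : nat) :
    {sigma_finite_measure set 'rV[R]_n -> \bar R} :=
  if n is n'.+1 then lebesgue_rVS (lebesgue_rV R n') else dirac (0 : 'rV[R]_0).

Lemma lebesgue_rV_prod (R : realType) (n : nat)
    (A : 'I_n -> set (measurableTypeR R)) : (forall i, measurable (A i)) ->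
  lebesgue_rV R n [set x | forall i, A i (x ord0 i)] =
  (\prod_(i < n) lebesgue_measure (A i))%E.
Proof.
elim: n A => [|n IHn] A mA.
  rewrite big_ord0 /= /dirac indicE mem_set// => -[].
  by move=> ? /=.
have mB : measurable [set x : 'rV[R]_n | forall i, A (lift ord0 i) (x ord0 i)].
  rewrite (_ : mkset _ = \bigcap_(i in [set: 'I_n])
    ((fun x : 'rV[R]_n => x ord0 i) @^-1` A (lift ord0 i))); last first.
    by apply/seteqP; split => [x Ax i _|x Ax i]; [exact: Ax|exact: (Ax i)].
  apply: fin_bigcap_measurable => // i _.
  rewrite -[X in measurable X]setTI.
  exact: (measurable_coord i measurableT (mA _)).
rewrite big_ord_recl -IHn; last by move=> i; exact: mA.
rewrite -product_measure1E//=.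
rewrite /lebesgue_rVS /pushforward; congr (_ _).
apply/seteqP; split => [p Ap|p [Ap0 ApS] i] /=.
  split => [|i]; first by have := Ap ord0; rewrite rV_cons0.
  by have := Ap (lift ord0 i); rewrite rV_consS.
by case: (unliftP ord0 i) => [j|] ->; rewrite ?rV_consS ?rV_cons0.
Qed.

Section domains.
Context {R : realType} {N : nat}.
Implicit Types (Omega K E U : set 'rV[R]_N) (f : 'rV[R]_N -> R) (x : 'rV[R]_N).

Definition partial (i : 'I_N) f : 'rV[R]_N -> R := 'D_(delta_mx ord0 i) f.

Definition laplacian f x : R := \sum_(i < N) partial i (partial i f) x.

(* Meaningful for U open only. *)
Fixpoint is_Ck (k : nat) U f : Prop :=
  (forall x, U x -> {for x, continuous f}) /\
  if k is k'.+1 then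
    forall i, (forall x, U x -> derivable f x (delta_mx ord0 i)) /\
              is_Ck k' U (partial i f)
  else True.

Definition is_smooth U f := forall k, is_Ck k U f.

Definition fsupport f : set 'rV[R]_N := closure [set x | f x != 0].

(* A function of C^k_c(Omega) is identified with its extension by 0, which is
   of class C^k on the whole space. *)
Definition is_Ckc (k : nat) Omega f :=
  [/\ is_Ck k setT f, compact (fsupport f) & fsupport f `<=` Omega].

Definition is_test Omega f := forall k, is_Ckc k Omega f.

Definition is_domain Omega := [/\ open Omega, connected Omega & Omega !=set0].

(* Near each of its boundary points, Omega is the strict sublevel set
   {phi < 0} of a C^oo function with non-vanishing gradient. *)
Definition smooth_boundary Omega :=
  forall x, (closure Omega `\` Omega°) x ->
    exists U phi,
      [/\ open U, U x, is_smooth U phi,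
          exists i, partial i phi x != 0 &
          Omega `&` U = [set y | U y /\ phi y < 0]].

End domains.

Section sobolev.
Context {R : realType} {N : nat}.
Implicit Types (Omega K : set 'rV[R]_N) (f g zeta L : 'rV[R]_N -> R).

Let leb := lebesgue_rV R N.

Definition L1 Omega f := leb.-integrable Omega (EFin \o f).

Definition L1loc Omega f := measurable_fun Omega f /\
  forall K, compact K -> K `<=` Omega -> L1 K f.

(* f \_ Omega is f set to 0 outside of Omega. *)
Definition Linfty Omega f := f \_ Omega \in Lfun leb +oo%E.

Definition weak_partial Omega (i : 'I_N) f g :=
  [/\ L1loc Omega f, L1loc Omega g &
    forall phi, is_test Omega phi ->
      (\int[leb]_(x in Omega) (f x * partial i phi x)%:E =
       - \int[leb]_(x in Omega) (g x * phi x)%:E)%E].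

(* L is a version of the Laplacian of f in the sense of weak derivatives. *)
Definition weak_laplacian Omega f L :=
  exists g h : 'I_N -> 'rV[R]_N -> R,
    (forall i, weak_partial Omega i f (g i) /\
               weak_partial Omega i (g i) (h i)) /\
    forall x, L x = \sum_(i < N) h i x.

Fixpoint Wkinfty (k : nat) Omega f : Prop :=
  Linfty Omega f /\
  if k is k'.+1 then
    forall i, exists2 g, weak_partial Omega i f g & Wkinfty k' Omega g
  else True.

(* The space W^{1,oo}_0(Omega) of the elements of W^{1,oo}(Omega) with zero
   trace; zeta is the continuous representative, which is the one to be
   integrated against a measure.  It is not the closure of the test functions
   in the norm of W^{1,oo}(Omega), whose elements have zero gradient on the
   boundary. *)
Definition W1infty0 Omega zeta :=
  [/\ Wkinfty 1 Omega zeta, {within closure Omega, continuous zeta} &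
      forall x, (closure Omega `\` Omega°) x -> zeta x = 0].

End sobolev.

Section good_measures.
Context {R : realType} {N : nat}.
Implicit Types (Omega K E : set 'rV[R]_N).

Let leb := lebesgue_rV R N.

(* A nonnegative bounded Radon measure on the open set Omega is a finite Borel
   measure on Omega (regularity is automatic); it is identified with the finite
   Borel measure on R^N it induces, for which the complement of Omega is
   null. *)
Definition carried_by Omega (mu : {finite_measure set 'rV[R]_N -> \bar R}) :=
  mu (~` Omega) = 0%E.

Definition weak_solution Omega
    (mu : {finite_measure set 'rV[R]_N -> \bar R}) (u : 'rV[R]_N -> R) :=
  [/\ L1 Omega u, L1 Omega (expR \o u) &
    forall zeta L, W1infty0 Omega zeta -> Wkinfty 2 Omega zeta ->
      weak_laplacian Omega zeta L ->
      (\int[leb]_(x in Omega) (- (u x * L x) + (expR (u x) - 1) * zeta x)%:E =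
       \int[mu]_(x in Omega) (zeta x)%:E)%E].

Definition good_measure Omega
    (mu : {finite_measure set 'rV[R]_N -> \bar R}) :=
  exists u, weak_solution Omega mu u.

Definition Pstar (t : R) : R := (`|t| + 1) * ln (`|t| + 1) - `|t|.

(* As extended reals, so that the infimum of the empty set is +oo. *)
Definition norm_LPstar Omega (phi : 'rV[R]_N -> R) : \bar R :=
  ereal_inf [set k%:E | k in
    [set k | 0 < k /\
      (\int[leb]_(x in Omega) (Pstar (phi x / k))%:E <= 1)%E]].

Definition cap_LlnL Omega K : \bar R :=
  ereal_inf [set norm_LPstar Omega (laplacian eta) | eta in
    [set eta | [/\ is_Ckc 2 Omega eta, (forall x, 0 <= eta x <= 1) &
                   K `<=` [set x | eta x = 1]°]]].

Definition zero_cap_LlnL Omega E :=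
  forall K, compact K -> K `<=` E -> cap_LlnL Omega K = 0%E.

End good_measures.

(* Main.v *)
(* Put w = - u and g = 1 - e^u on Omega, both extended by 0, so that
   Delta w = g + mu weakly.  Let K be a compact set of zero capacity, chi >= 0 a
   C^2_c cutoff with chi = 1 on K, and eta a test function of K for the capacity.
   Then mu(K) <= int eta chi dmu = int w Delta(eta chi) - int g eta chi.

   No global sign of u is available without solving a Dirichlet problem, so w is
   split as a + phi(w - k), where phi is a smooth convex function close to the
   positive part.  As g >= 0 where w >= 0, Kato's inequality makes phi(w - k)
   subharmonic in Omega, hence, since eta <= 1,
     int phi(w - k) Delta(eta chi) <= int phi(w - k) Delta chi,
   which tends to 0 as k -> oo uniformly in eta.

   For fixed k, e^|a| is integrable.  In Delta(eta chi) = chi Delta eta +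
   2 grad eta . grad chi + eta Delta chi, the first term is controlled by Young's
   inequality x y <= e^x + P*(y), the second one by
   int |grad eta|^2 = - int eta Delta eta <= int |Delta eta|, and the last one
   (as well as the term with g) by 2 int eta = int x_1^2 Delta eta.  All of them
   vanish as the norm of Delta eta tends to 0. *)

Require Import Defs.
From mathcomp Require Import all_boot all_order all_algebra.
From mathcomp Require Import all_classical all_reals all_analysis.
From mathcomp Require Import measurable_realfun ring lra.
Import Order.TTheory GRing.Theory Num.Theory.
Import numFieldNormedType.Exports.
Local Open Scope classical_set_scope.
Local Open Scope ring_scope.
Set Implicit Arguments.
Unset Strict Implicit.
Unset Printing Implicit Defensive.

(** * Directional derivatives and C^k functions *)

(** The obstacle is that exponential integrability is one-sided: [e^u] is integrable, so [e^(-w)]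
    is, but nothing controls [e^w] where [w] is large and positive, while Young's inequality asks
    for [e^|a|]. Cutting [w] above the level [k] leaves an [a] with [0 <= a <= k + 2] wherever
    [w > 0]. Convexity handles the part cut off, by an estimate in which [eta] no longer occurs.
    This permits the order of choices: [k] first, then a truncation level [M] and a weight [dl], and
    only at the end the bound [kp] on the norm of the Laplacian, hence [eta] itself.

    Kato's inequality is proved by mollifying [w] and [g]. Mollification loses the information that
    [g >= 0] where [w > k], so [phi'] at the mollified function has to be compared with [phi'] at
    [w]; for this [phi''] must be bounded, which rules out the positive part itself.

    The passage from compact sets to Borel sets is by inner regularity of [mu]. *)

Section derivatives.
Context {R : realType} {V : normedModType R}.
Implicit Types (f g : V -> R) (x v : V).

(** Restriction to a line makes the chain rule and the mean value theorem of one real variable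
    available for directional derivatives, without total differentiability. *)
Lemma is_derive_line f x v (t d : R) : is_derive (t *: v + x) v f d ->
  is_derive t 1 (fun s : R => f (s *: v + x)) d.
Proof.
have E : (fun h : R => h^-1 *: (((fun s : R => f (s *: v + x)) \o shift t) (h *: 1)
      - f (t *: v + x))) =
    (fun h => h^-1 *: ((f \o shift (t *: v + x)) (h *: v) - f (t *: v + x))).
  apply/funext => h /=; congr (_ *: (f _ - _)).
  by rewrite scalerDl addrA [h%:A]mulr1.
by move=> [df <-]; split; rewrite /derivable /derive E.
Qed.

Lemma is_derive_line0 f x v (d : R) :
  is_derive (0 : R) 1 (fun s : R => f (s *: v + x)) d -> is_derive x v f d.
Proof.
have E : (fun h : R => h^-1 *: (((fun s : R => f (s *: v + x)) \o shift 0) (h *: 1)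
      - f (0 *: v + x))) =
    (fun h => h^-1 *: ((f \o shift x) (h *: v) - f x)).
  apply/funext => h /=; rewrite scale0r add0r addr0.
  by rewrite [h%:A]mulr1.
by move=> [df <-]; split; move: df; rewrite /derivable /derive /= E.
Qed.

Lemma is_derive_comp_real (phi : R -> R) f x v (a b : R) :
  is_derive x v f a -> is_derive (f x) 1 phi b ->
  is_derive x v (phi \o f) (b * a).
Proof.
move=> fa phib; apply: is_derive_line0.
have f0 : is_derive (0 : R) 1 (fun s : R => f (s *: v + x)) a.
  by apply: is_derive_line; rewrite scale0r add0r.
apply: (@is_derive1_comp _ phi (fun s : R => f (s *: v + x)) 0 b a) => //.
by rewrite scale0r add0r.
Qed.

Lemma is_derive_translate f x v c (d : R) : is_derive (x + c) v f d ->
  is_derive x v (fun y => f (y + c)) d.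
Proof.
move=> fd; apply: is_derive_line0.
have := @is_derive_line f (x + c) v 0 d.
rewrite scale0r add0r => /(_ fd).
by under eq_fun do rewrite addrA.
Qed.

(** The increment [h] may be negative, so the intermediate point is located by absolute values. *)
Lemma MVT_dir f (df : V -> R) x v (h : R) : (forall y, is_derive y v f (df y)) ->
  exists2 t : R, `|t| <= `|h| & f (h *: v + x) - f x = df (t *: v + x) * h.
Proof.
move=> fdf.
have dl (t : R) : is_derive t 1 (fun s : R => f (s *: v + x)) (df (t *: v + x)).
  exact: is_derive_line.
have cl : continuous (fun s : R => f (s *: v + x)).
  move=> t; apply: differentiable_continuous; apply/derivable1_diffP.
  by have [] := dl t.
have [h0|h0] := leP 0 h.
  have [|c] := MVT_segment h0 (fun t _ => dl t).
    exact: continuous_subspaceT.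
  rewrite scale0r add0r subr0 in_itv/= => /andP[c0 ch] E.
  by exists c => //; rewrite !ger0_norm.
have [|c] := MVT_segment (ltW h0) (fun t _ => dl t).
  exact: continuous_subspaceT.
rewrite scale0r add0r sub0r in_itv/= => /andP[c0 ch] E; exists c.
  by rewrite !ler0_norm ?lerN2// ltW.
by rewrite -opprB E mulrN opprK.
Qed.

End derivatives.

Section Ck_calculus.
Context {R : realType} {N : nat}.
Implicit Types (f g : 'rV[R]_N -> R) (x : 'rV[R]_N) (k : nat).

Local Notation e i := (delta_mx ord0 i : 'rV[R]_N).

Lemma is_Ck_continuous k f : is_Ck k setT f -> continuous f.
Proof. by case: k => [|k] [cf _] x; exact: cf. Qed.

Lemma is_Ck_partial k f i : is_Ck k.+1 setT f -> is_Ck k setT (partial i f).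
Proof. by move=> [_ /(_ i)[]]. Qed.

Lemma is_Ck_is_derive k f i x : is_Ck k.+1 setT f ->
  is_derive x (e i) f (partial i f x).
Proof. by move=> [_ /(_ i)[df _]]; apply: derivableP; exact: df. Qed.

Lemma partial_val f i x d : is_derive x (e i) f d -> partial i f x = d.
Proof. by move=> [_ <-]. Qed.

Lemma is_Ck_intro k f (df : 'I_N -> 'rV[R]_N -> R) : continuous f ->
    (forall i x, is_derive x (e i) f (df i x)) ->
    (forall i, is_Ck k setT (df i)) ->
  is_Ck k.+1 setT f.
Proof.
move=> cf fdf dfk; split=> [x _|i]; first exact: cf.
split=> [x _|]; first by have [] := fdf i x.
by rewrite (_ : partial i f = df i)//; apply/funext => x; exact: partial_val.
Qed.

Lemma is_CkS k f : is_Ck k.+1 setT f -> is_Ck k setT f.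
Proof.
elim: k f => [|k IH] f; first by move=> [].
by move=> [cf df]; split=> // i; have [? ?] := df i; split=> //; exact: IH.
Qed.

Lemma is_Ck_cst k (c : R) : is_Ck k setT (fun _ : 'rV[R]_N => c).
Proof.
elim: k c => [|k IH] c; first by split=> // x _; exact: cst_continuous.
by apply: (@is_Ck_intro k _ (fun=> fun=> 0)) => [x|_]; [exact: cst_continuous|exact: IH].
Qed.

Lemma is_CkD k f g : is_Ck k setT f -> is_Ck k setT g ->
  is_Ck k setT (fun x => f x + g x).
Proof.
elim: k f g => [|k IH] f g fk gk.
  split=> // x _.
  by apply: continuousD; [exact: (is_Ck_continuous fk)|exact: (is_Ck_continuous gk)].
apply: (@is_Ck_intro k _ (fun i x => partial i f x + partial i g x)) => [x|i x|i].
- by apply: continuousD; [exact: (is_Ck_continuous fk)|exact: (is_Ck_continuous gk)].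
- by apply: is_deriveD; apply: is_Ck_is_derive; [exact: fk|exact: gk].
- by apply: IH; exact: is_Ck_partial.
Qed.

Lemma is_CkM k f g : is_Ck k setT f -> is_Ck k setT g ->
  is_Ck k setT (fun x => f x * g x).
Proof.
elim: k f g => [|k IH] f g fk gk.
  split=> // x _.
  by apply: continuousM; [exact: (is_Ck_continuous fk)|exact: (is_Ck_continuous gk)].
apply: (@is_Ck_intro k _
  (fun i x => f x * partial i g x + g x * partial i f x)) => [x|i x|i].
- by apply: continuousM; [exact: (is_Ck_continuous fk)|exact: (is_Ck_continuous gk)].
- by apply: is_deriveM; apply: is_Ck_is_derive; [exact: fk|exact: gk].
- by apply: is_CkD; apply: IH; by [exact: is_CkS|exact: is_Ck_partial].
Qed.

Lemma is_CkN k f : is_Ck k setT f -> is_Ck k setT (fun x => - f x).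
Proof.
move=> fk; under eq_fun do rewrite -mulN1r.
by apply: is_CkM => //; exact: is_Ck_cst.
Qed.

Lemma is_CkB k f g : is_Ck k setT f -> is_Ck k setT g ->
  is_Ck k setT (fun x => f x - g x).
Proof. by move=> fk gk; apply: is_CkD => //; exact: is_CkN. Qed.

Lemma is_Ck_sum k I (r : seq I) (F : I -> 'rV[R]_N -> R) :
  (forall i, is_Ck k setT (F i)) -> is_Ck k setT (fun x => \sum_(i <- r) F i x).
Proof.
move=> Fk; elim: r => [|i r IH].
  by under eq_fun do rewrite big_nil; exact: is_Ck_cst.
by under eq_fun do rewrite big_cons; exact: is_CkD.
Qed.

Lemma is_derive_coord (j i : 'I_N) x :
  is_derive x (e i) (fun y : 'rV[R]_N => y ord0 j) (j == i)%:R.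
Proof.
apply: is_derive_line0; pose c : R := (j == i)%:R.
have h : is_derive (0 : R) 1 ((c \*: (id : R -> R)) + cst (x ord0 j)) (c *: (1 : R) + 0).
  exact: is_deriveD.
apply: (is_derive_eq (f' := c *: (1 : R) + 0)); last by rewrite addr0 [LHS]mulr1.
rewrite (_ : (fun s : R => _) = (c \*: (id : R -> R)) + cst (x ord0 j)) //.
by apply/funext => s; rewrite !mxE eqxx/= mulrC.
Qed.

Lemma is_Ck_coord k (j : 'I_N) : is_Ck k setT (fun x : 'rV[R]_N => x ord0 j).
Proof.
have cj : continuous (fun x : 'rV[R]_N => x ord0 j) by exact: coord_continuous.
case: k => [|k]; first by split=> // x _; exact: cj.
by apply: (@is_Ck_intro k _ (fun i _ => (j == i)%:R)) => // [i x|i];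
  [exact: is_derive_coord|exact: is_Ck_cst].
Qed.

Lemma is_Ck_translate k f c : is_Ck k setT f -> is_Ck k setT (fun x => f (x + c)).
Proof.
have cont f' : continuous f' -> continuous (fun x => f' (x + c)).
  move=> cf x.
  have h : continuous (fun y : 'rV[R]_N => y + c).
    by move=> y; apply: (@continuousD _ _ _ id (cst c)); [exact: cvg_id|exact: cst_continuous].
  exact: (continuous_comp (h x) (cf _)).
elim: k f => [|k IH] f fk.
  by split=> // x _; exact: (cont _ (is_Ck_continuous fk)).
apply: (@is_Ck_intro k _ (fun i x => partial i f (x + c))) => [|i x|i].
- exact: (cont _ (is_Ck_continuous fk)).
- by apply: is_derive_translate; exact: is_Ck_is_derive fk.
- by apply: IH; exact: is_Ck_partial.
Qed.

Lemma is_C1_comp (phi phi1 : R -> R) f :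
  (forall t : R, is_derive t 1 phi (phi1 t)) -> continuous phi1 ->
  is_Ck 1 setT f -> is_Ck 1 setT (phi \o f).
Proof.
move=> dphi cphi1 f1.
have cphi : continuous phi.
  move=> t; apply: differentiable_continuous; apply/derivable1_diffP.
  by have [] := dphi t.
have cf := is_Ck_continuous f1.
apply: (@is_Ck_intro 0 _ (fun i x => phi1 (f x) * partial i f x)) => [x|i x|i].
- by apply: continuous_comp; [exact: cf|exact: cphi].
- by apply: is_derive_comp_real => //; exact: is_Ck_is_derive f1.
- split=> // x _; apply: continuousM.
    by apply: continuous_comp; [exact: cf|exact: cphi1].
  exact: (is_Ck_continuous (is_Ck_partial i f1)).
Qed.

Lemma is_C2_comp (phi phi1 phi2 : R -> R) f :
  (forall t : R, is_derive t 1 phi (phi1 t)) ->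
  (forall t : R, is_derive t 1 phi1 (phi2 t)) -> continuous phi2 ->
  is_Ck 2 setT f -> is_Ck 2 setT (phi \o f).
Proof.
move=> dphi dphi1 cphi2 f2.
have cphi : continuous phi.
  move=> t; apply: differentiable_continuous; apply/derivable1_diffP.
  by have [] := dphi t.
have cf := is_Ck_continuous f2.
apply: (@is_Ck_intro 1 _ (fun i x => phi1 (f x) * partial i f x)) => [x|i x|i].
- by apply: continuous_comp; [exact: cf|exact: cphi].
- by apply: is_derive_comp_real => //; exact: is_Ck_is_derive f2.
- apply: is_CkM; last exact: is_Ck_partial.
  by apply: (is_C1_comp dphi1 cphi2); exact: is_CkS.
Qed.

Lemma partial_comp (phi phi1 : R -> R) f i :
  (forall t : R, is_derive t 1 phi (phi1 t)) -> is_Ck 1 setT f ->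
  partial i (phi \o f) = (fun x => phi1 (f x) * partial i f x).
Proof.
move=> dphi f1; apply/funext => x; apply: partial_val.
by apply: is_derive_comp_real => //; exact: is_Ck_is_derive f1.
Qed.

Lemma partialM f g i : is_Ck 1 setT f -> is_Ck 1 setT g ->
  partial i (fun x => f x * g x) =
  (fun x => f x * partial i g x + g x * partial i f x).
Proof.
move=> f1 g1; apply/funext => x; apply: partial_val.
by apply: is_deriveM; apply: is_Ck_is_derive; [exact: f1|exact: g1].
Qed.

Lemma partialD f g i : is_Ck 1 setT f -> is_Ck 1 setT g ->
  partial i (fun x => f x + g x) = (fun x => partial i f x + partial i g x).
Proof.
move=> f1 g1; apply/funext => x; apply: partial_val.
by apply: is_deriveD; apply: is_Ck_is_derive; [exact: f1|exact: g1].
Qed.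

Lemma partialB f g i : is_Ck 1 setT f -> is_Ck 1 setT g ->
  partial i (fun x => f x - g x) = (fun x => partial i f x - partial i g x).
Proof.
move=> f1 g1; apply/funext => x; apply: partial_val.
by apply: is_deriveB; apply: is_Ck_is_derive; [exact: f1|exact: g1].
Qed.

Lemma partial_translate f c i : is_Ck 1 setT f ->
  partial i (fun x => f (x + c)) = (fun x => partial i f (x + c)).
Proof.
move=> f1; apply/funext => x; apply: partial_val.
by apply: is_derive_translate; exact: is_Ck_is_derive f1.
Qed.

Lemma laplacianM f g x : is_Ck 2 setT f -> is_Ck 2 setT g ->
  laplacian (fun y => f y * g y) x = f x * laplacian g x +
    2 * (\sum_(i < N) partial i f x * partial i g x) + g x * laplacian f x.
Proof.
move=> f2 g2; rewrite /laplacian !mulr_sumr -!big_split/=.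
apply: eq_bigr => i _; rewrite partialM; [|exact: is_CkS..].
rewrite partialD; first last.
- by apply: is_CkM; [exact: is_CkS|exact: is_Ck_partial].
- by apply: is_CkM; [exact: is_CkS|exact: is_Ck_partial].
rewrite (partialM i (is_CkS f2) (is_Ck_partial i g2)).
rewrite (partialM i (is_CkS g2) (is_Ck_partial i f2)).
move: (partial i (partial i f) x) (partial i (partial i g) x) => a b.
move: (partial i f x) (partial i g x) (f x) (g x) => c d r s.
ring.
Qed.

Lemma laplacianB f g x : is_Ck 2 setT f -> is_Ck 2 setT g ->
  laplacian (fun y => f y - g y) x = laplacian f x - laplacian g x.
Proof.
move=> f2 g2; rewrite /laplacian -sumrB.
apply: eq_bigr => i _; rewrite partialB; [|exact: is_CkS..].
by rewrite partialB//; exact: is_Ck_partial.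
Qed.

Lemma laplacian_translate f c x : is_Ck 2 setT f ->
  laplacian (fun y => f (y + c)) x = laplacian f (x + c).
Proof.
move=> f2; rewrite /laplacian.
apply: eq_bigr => i _; rewrite partial_translate; [|exact: is_CkS..].
by rewrite partial_translate//; exact: is_Ck_partial.
Qed.

Lemma laplacian_comp (phi phi1 phi2 : R -> R) f x :
  (forall t : R, is_derive t 1 phi (phi1 t)) ->
  (forall t : R, is_derive t 1 phi1 (phi2 t)) -> continuous phi2 ->
  is_Ck 2 setT f ->
  laplacian (phi \o f) x =
    phi1 (f x) * laplacian f x + phi2 (f x) * \sum_(i < N) partial i f x ^+ 2.
Proof.
move=> dphi dphi1 cphi2 f2; rewrite /laplacian !mulr_sumr -big_split/=.
apply: eq_bigr => i _; rewrite (partial_comp i dphi (is_CkS f2)).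
rewrite (@partialM (phi1 \o f)); first last.
- exact: is_Ck_partial.
- by apply: is_C1_comp dphi1 cphi2 _; exact: is_CkS.
rewrite (partial_comp i dphi1 (is_CkS f2)) /=.
move: (partial i (partial i f) x) (partial i f x) => a b.
move: (phi1 (f x)) (phi2 (f x)) => r s.
ring.
Qed.

Lemma is_C0_laplacian f : is_Ck 2 setT f -> continuous (laplacian f).
Proof.
move=> f2; apply: (@is_Ck_continuous 0).
by apply: is_Ck_sum => i; exact/is_Ck_partial/is_Ck_partial.
Qed.

End Ck_calculus.

(** * Lebesgue measure on R^N *)

Section borel_sets.
Context {R : realType} {N : nat}.

Lemma closed_measurable_rV (A : set 'rV[R]_N) : closed A -> measurable A.
Proof.
move=> cA; rewrite -[A]setCK; apply: measurableC; apply: open_measurable_rV.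
exact: closed_openC.
Qed.

Lemma continuous_measurable_rV (f : 'rV[R]_N -> R) : continuous f ->
  measurable_fun [set: 'rV[R]_N] f.
Proof.
move=> cf; apply: (measurability _ (RGenOpens.measurableE R)) => _ [_ [a [b ->]] <-].
rewrite setTI; apply: open_measurable_rV.
by apply: open_comp; [move=> x _; exact: cf|exact: interval_open].
Qed.

Lemma measurable_translate (c : 'rV[R]_N) :
  measurable_fun [set: 'rV[R]_N] (fun x => x + c).
Proof.
apply: measurable_fun_rV => i; apply: continuous_measurable_rV => x.
apply: (@is_Ck_continuous _ _ 0 (fun y : 'rV[R]_N => (y + c) ord0 i)).
exact: (is_Ck_translate c (is_Ck_coord 0 i)).
Qed.

Lemma measurable_rV_add : measurable_fun [set: 'rV[R]_N * 'rV[R]_N]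
  (fun p => p.1 + p.2).
Proof.
apply: measurable_fun_rV => i.
under eq_fun do rewrite mxE.
apply: measurable_funD.
  exact: (measurableT_comp (measurable_coord i) measurable_fst).
exact: (measurableT_comp (measurable_coord i) measurable_snd).
Qed.

(** The norm of row vectors is the maximum norm: its balls are cubes, whose volume is given by
    [lebesgue_rV_prod]. The sign condition on [M] matters for the empty vector. *)
Lemma le_rV_norm (x : 'rV[R]_N) (M : R) : 0 <= M ->
  (forall i, `|x ord0 i| <= M) <-> `|x| <= M.
Proof.
have E : `|x| = \big[Num.max/0]_(ij : 'I_1 * 'I_N) `|x ij.1 ij.2| by exact: mx_normrE.
move=> M0; rewrite E; split=> [xM|].
  by apply/bigmax_leP; split=> // -[i j] _; rewrite /= ord1.
by move=> /bigmax_leP[_ xM] i; exact: (xM (ord0, i)).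
Qed.

Lemma closed_norm_le (M : R) : closed [set x : 'rV[R]_N | `|x| <= M].
Proof.
apply: (@closed_comp _ _ (fun x : 'rV[R]_N => `|x|) [set t : R | t <= M]).
  by move=> x _; exact: norm_continuous.
exact: closed_le.
Qed.

Lemma lebesgue_rV_norm_le_fin (M : R) :
  (lebesgue_rV R N [set x | `|x| <= M]%R < +oo)%E.
Proof.
have [M0|M0] := leP 0 M; last first.
  rewrite (_ : mkset _ = set0) ?measure0//.
  by apply/seteqP; split=> // x /=; rewrite leNgt (lt_le_trans M0).
have -> : [set x : 'rV[R]_N | `|x| <= M] =
    [set x | forall i, (fun=> [set` `[- M, M]]) i (x ord0 i)].
  apply/seteqP; split=> x /=.
    by move=> /(le_rV_norm _ M0) xM i; rewrite in_itv/= -ler_norml.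
  by move=> xM; apply/(le_rV_norm _ M0) => i; rewrite ler_norml; have := xM i; rewrite in_itv.
rewrite (@lebesgue_rV_prod R N (fun=> [set` `[- M, M]]))//.
rewrite -ge0_fin_numE; last by apply: prode_ge0.
by elim/big_rec : _ => // i x _ xf; rewrite fin_numM// lebesgue_measure_itv/=; case: ifP.
Qed.

End borel_sets.

(** * Translation invariance of the Lebesgue measure *)

Section translation.
Context {R : realType}.

(** By uniqueness of the Lebesgue measure: the pushforward by the translation has the right value on
    the intervals []a, b]]. *)
Lemma lebesgue_measure_translate (c : R) (A : set (measurableTypeR R)) :
  measurable A -> lebesgue_measure ((fun x : R => x + c) @^-1` A) = lebesgue_measure A.
Proof.
have ms : measurable_fun [set: measurableTypeR R]
    ((fun x : R => x + c) : measurableTypeR R -> measurableTypeR R).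
  by apply: measurable_funD => //; exact: measurable_cst.
move=> mA; apply/esym.
apply: (@lebesgue_measure_unique _ (pushforward lebesgue_measure
  ((fun x : R => x + c) : measurableTypeR R -> measurableTypeR R))) => //.
move=> _ [[a b]] _ <-; rewrite /pushforward.
transitivity (@lebesgue_measure R `]a - c, b - c]%classic); last first.
  congr (lebesgue_measure _); apply/seteqP; split=> x /=;
    by rewrite !in_itv/= lerBrDr ltrBlDr.
rewrite !lebesgue_measure_itv/= !lte_fin ltrD2r.
by case: ifP => // _; rewrite -!EFinD; congr EFin; ring.
Qed.

(** Induction on the dimension. The product measure integrates the measures of sections over the
    first coordinate; the induction hypothesis translates each section, and the one-dimensional case
    translates the variable of integration. *)
Lemma lebesgue_rV_translate N (c : 'rV[R]_N) (A : set 'rV[R]_N) : measurable A ->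
  lebesgue_rV R N ((fun x => x + c) @^-1` A) = lebesgue_rV R N A.
Proof.
elim: N c A => [|N IH] c A mA.
  congr (_ _); apply/seteqP; split => x /=; first by rewrite thinmx0 (thinmx0 x).
  by rewrite [in X in _ -> X]thinmx0 (thinmx0 x).
pose c0 := (rV_uncons c).1; pose c' := (rV_uncons c).2.
have consD p : rV_cons p + c = rV_cons (p.1 + c0, p.2 + c').
  apply/rowP => i; rewrite mxE; case: (unliftP ord0 i) => [j|] ->.
    by rewrite !rV_consS !mxE.
  by rewrite !rV_cons0.
have mB : measurable (@rV_cons R N @^-1` A).
  by rewrite -[X in measurable X]setTI; exact: measurable_rV_cons.
set B := @rV_cons R N @^-1` A in mB.
change ((lebesgue_measure \x lebesgue_rV R N)%E
  (@rV_cons R N @^-1` ((fun x => x + c) @^-1` A)) =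
  (lebesgue_measure \x lebesgue_rV R N)%E B).
have -> : @rV_cons R N @^-1` ((fun x => x + c) @^-1` A) =
    (fun p : measurableTypeR R * 'rV[R]_N => (p.1 + c0, p.2 + c')) @^-1` B.
  by apply/seteqP; split => p /=; rewrite /B/= consD.
rewrite /product_measure1.
transitivity (\int[@lebesgue_measure R]_x
   (lebesgue_rV R N (xsection B (x + c0)%R)))%E.
  apply: eq_integral => x _ /=.
  rewrite -(IH c' (xsection B (x + c0)%R)); last exact: measurable_xsection.
  by congr (lebesgue_rV R N _).
have ms : measurable_fun [set: measurableTypeR R]
    ((fun x : R => x + c0) : measurableTypeR R -> measurableTypeR R).
  by apply: measurable_funD => //; exact: measurable_cst.
have := @ge0_integral_pushforward _ _ _ _ R
  ((fun x : R => x + c0) : measurableTypeR R -> measurableTypeR R) ms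
  lebesgue_measure setT (lebesgue_rV R N \o xsection B) measurableT.
rewrite preimage_setT => <-; first last.
- by move=> y _; exact: measure_ge0.
- exact: measurable_fun_xsection.
apply: eq_measure_integral => C mC _.
exact: lebesgue_measure_translate.
Qed.

End translation.

(** * Integrals of real-valued functions *)

Section real_integrals.
Context d (T : measurableType d) (R : realType) (mu : {measure set T -> \bar R}).
Implicit Types f g : T -> R.
Local Notation intg f := (mu.-integrable [set: T] (EFin \o f)).

Lemma intg_measurable f : intg f -> measurable_fun setT f.
Proof. by move=> /measurable_int/measurable_EFinP. Qed.

Lemma intg_le f g : measurable_fun setT f -> intg g ->
  (forall x, `|f x| <= g x) -> intg f.
Proof.
move=> mf ig fg; apply: le_integrable ig => //; first exact/measurable_EFinP.
by move=> x _ /=; rewrite lee_fin (le_trans (fg x))// ler_norm.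
Qed.

Lemma intgD f g : intg f -> intg g -> intg (fun x => f x + g x).
Proof.
move=> fi gi.
have := integrableD measurableT fi gi.
by apply: eq_integrable => // x _; rewrite /= EFinD.
Qed.

Lemma intgZ (k : R) f : intg f -> intg (fun x => k * f x).
Proof.
move=> fi; have := integrableZl measurableT k fi.
by apply: eq_integrable => // x _; rewrite /= EFinM.
Qed.

Lemma intgN f : intg f -> intg (fun x => - f x).
Proof. by move=> /(intgZ (-1)); under eq_fun do rewrite mulN1r. Qed.

Lemma intgB f g : intg f -> intg g -> intg (fun x => f x - g x).
Proof. by move=> fi gi; apply: intgD => //; exact: intgN. Qed.

Lemma intg_norm f : intg f -> intg (fun x => `|f x|).
Proof. exact: integrable_norm. Qed.

Lemma intg_sum I (r : seq I) (F : I -> T -> R) : (forall i, intg (F i)) ->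
  intg (fun x => \sum_(i <- r) F i x).
Proof.
move=> Fi; elim: r => [|i r IH].
  by under eq_fun do rewrite big_nil; exact: integrable0.
by under eq_fun do rewrite big_cons; exact: intgD.
Qed.

Lemma intgM_bounded f g (C : R) : intg f -> measurable_fun setT g ->
  (forall x, `|g x| <= C) -> intg (fun x => f x * g x).
Proof.
move=> fi mg gC; apply: (@intg_le _ (fun x => C * `|f x|)).
- by apply: measurable_funM => //; exact: intg_measurable.
- by apply: intgZ; exact: intg_norm.
- by move=> x; rewrite normrM mulrC ler_wpM2r.
Qed.

Lemma Rintegral_sum I (r : seq I) (F : I -> T -> R) : (forall i, intg (F i)) ->
  (\int[mu]_x (\sum_(i <- r) F i x) = \sum_(i <- r) \int[mu]_x F i x)%R.
Proof.
move=> Fi; elim: r => [|i r IH].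
  under eq_Rintegral do rewrite big_nil.
  by rewrite big_nil /Rintegral integral0.
under eq_Rintegral do rewrite big_cons.
by rewrite big_cons RintegralD// ?IH//; exact: intg_sum.
Qed.

Lemma EFin_Rintegral f : intg f ->
  ((\int[mu]_x f x)%R%:E = \int[mu]_x (f x)%:E)%E.
Proof. by move=> fi; rewrite /Rintegral fineK//; exact: integrable_fin_num. Qed.

Lemma normr_Rintegral_le f g : intg f -> intg g -> (forall x, `|f x| <= g x) ->
  `|\int[mu]_x f x| <= \int[mu]_x g x.
Proof.
move=> fi gi fg; apply: (le_trans (le_normr_Rintegral measurableT fi)).
by apply: le_Rintegral => //; exact: intg_norm.
Qed.

Lemma intg_indic (D : set T) : measurable D -> (mu D < +oo)%E ->
  intg (fun x => \1_D x : R).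
Proof.
move=> mD Dfin; apply/integrableP; split; first by apply/measurable_EFinP; exact: measurable_indic.
under eq_integral do rewrite gee0_abs ?lee_fin//.
by rewrite integral_indic// setIT.
Qed.

(** Dominated convergence along integer levels. The excess [(|f| - M)^+] replaces truncation
    throughout: [|f| <= M + (|f| - M)^+] separates a bounded part from a part that is small in the
    mean. It also provides the level [k] of the main estimate. *)
Lemma intg_tail f (e : R) : intg f -> 0 < e ->
  exists2 M : R, 0 <= M & \int[mu]_x (Num.max (`|f x| - M) 0) <= e.
Proof.
move=> fi e0.
have mf := intg_measurable fi.
have mh n : measurable_fun setT (fun x => Num.max (`|f x| - n%:R) 0).
  apply: measurable_maxr => //; apply: measurable_funB => //.
  exact: measurableT_comp.
have hle n x : `|Num.max (`|f x| - n%:R) 0| <= `|f x|.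
  rewrite ger0_norm ?le_max ?lexx ?orbT// ge_max normr_ge0 andbT.
  by rewrite lerBlDr lerDl.
have hi n : intg (fun x => Num.max (`|f x| - n%:R) 0).
  exact: (intg_le (mh n) (intg_norm fi)).
have [] := @dominated_convergence _ _ _ mu setT measurableT
   (fun n x => (Num.max (`|f x| - n%:R) 0)%:E) (cst 0%E) (fun x => `|f x|%:E).
- by move=> n; exact/measurable_EFinP.
- exact: measurable_cst.
- apply: aeW => x _; apply: cvg_near_cst; near=> n.
  rewrite max_r// subr_le0; apply: ltW.
  by near: n; exact: nbhs_infty_gtr.
- exact: intg_norm.
- by apply: aeW => x n _; rewrite lee_fin.
move=> _ _; rewrite integral0 => /fine_cvgP[_] /cvgrPdist_le /(_ _ e0)[n _ /(_ n)].
rewrite /= => /(_ (leqnn n)) h; exists n%:R => //.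
move: h; rewrite sub0r normrN => h; apply: (le_trans _ h).
exact: ler_norm.
Unshelve. all: by end_near. Qed.

End real_integrals.

(** * Functions of bounded support and integration of derivatives *)

Section compact_support.
Context {R : realType} {N : nat}.
Implicit Types f : 'rV[R]_N -> R.
Local Notation leb := (lebesgue_rV R N).
Local Notation intg f := (leb.-integrable [set: 'rV[R]_N] (EFin \o f)).
Local Notation e i := (delta_mx ord0 i : 'rV[R]_N).

(** A substitute for compact support that mentions neither a closure nor a domain. It is stable
    under sums, partial derivatives and products with any function; for continuous functions it
    yields boundedness, integrability and uniform continuity. *)
Definition bounded_support f := exists M : R, forall x, M < `|x| -> f x = 0.

Lemma is_Ckc_bounded_support k Omega f : is_Ckc k Omega f -> bounded_support f.
Proof.
move=> [_ /compact_bounded[M [_ KM]] _]; exists (M + 1) => x Mx.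
apply/eqP/negP => /negP fx.
have /KM /(_ x) : M < M + 1 by rewrite ltrDl.
have : fsupport f x by apply: subset_closure.
by move=> fsx /(_ fsx); rewrite /= leNgt Mx.
Qed.

Lemma bounded_supportM f g : bounded_support f ->
  bounded_support (fun x => f x * g x).
Proof. by move=> [M fM]; exists M => x /fM ->; rewrite mul0r. Qed.

Lemma bounded_supportMr f g : bounded_support f ->
  bounded_support (fun x => g x * f x).
Proof. by move=> [M fM]; exists M => x /fM ->; rewrite mulr0. Qed.

Lemma bounded_supportD f g : bounded_support f -> bounded_support g ->
  bounded_support (fun x => f x + g x).
Proof.
move=> [M fM] [M' gM]; exists (Num.max M M') => x; rewrite gt_max => /andP[Mx M'x].
by rewrite fM// gM// addr0.
Qed.

Lemma bounded_support_sum I (r : seq I) (F : I -> 'rV[R]_N -> R) :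
  (forall i, bounded_support (F i)) ->
  bounded_support (fun x => \sum_(i <- r) F i x).
Proof.
move=> bF; elim: r => [|i r IH]; first by exists 0 => x _; rewrite big_nil.
by under eq_fun do rewrite big_cons; exact: bounded_supportD.
Qed.

Lemma partial_near0 f i x : (\near x, f x = 0) -> partial i f x = 0.
Proof.
move=> f0; apply: partial_val.
apply: (near_eq_is_derive (f := cst 0)).
by near do apply/esym.
Unshelve. all: by end_near. Qed.

Lemma near_norm_gt (M : R) (x : 'rV[R]_N) : M < `|x| -> \near x, M < `|x|.
Proof.
move=> Mx; have : (fun y : 'rV[R]_N => `|y|) @ x --> `|x| by exact: norm_continuous.
by move=> /cvgr_gt; apply.
Qed.

Lemma bounded_support_partial f i : bounded_support f -> bounded_support (partial i f).
Proof.
move=> [M fM]; exists M => x Mx; apply: partial_near0.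
by near=> y; apply: fM; near: y; exact: near_norm_gt.
Unshelve. all: by end_near. Qed.

Lemma bounded_support_laplacian f : bounded_support f -> bounded_support (laplacian f).
Proof.
move=> bf; apply: bounded_support_sum => i.
by do 2 apply: bounded_support_partial.
Qed.

Lemma compact_norm_le (M : R) : compact [set x : 'rV[R]_N | `|x| <= M].
Proof.
apply: bounded_closed_compact; last exact: closed_norm_le.
exists M; split=> [|t Mt x /= xM]; first exact: num_real.
by rewrite (le_trans xM)// ltW.
Qed.

Lemma bounded_support_bounded f : continuous f -> bounded_support f ->
  exists2 C : R, 0 <= C & forall x, `|f x| <= C.
Proof.
move=> cf [M fM].
have : compact (f @` [set x : 'rV[R]_N | `|x| <= M]).
  apply: continuous_compact; last exact: compact_norm_le.
  exact: continuous_subspaceT.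
move=> /compact_bounded[C [_ KC]]; exists (`|C| + 1) => [|x]; first exact: addr_ge0.
have [xM|/fM ->] := leP `|x| M; last by rewrite normr0 addr_ge0.
by apply: (KC (`|C| + 1)); [rewrite ltr_pwDr// ler_norm|exists x].
Qed.

Lemma bounded_support_intg f : continuous f -> bounded_support f -> intg f.
Proof.
move=> cf /[dup] bf [M fM]; have [C C0 fC] := bounded_support_bounded cf bf.
apply: (@intg_le _ _ _ leb _ (fun x => C * \1_[set x : 'rV[R]_N | `|x| <= M] x)).
- exact: continuous_measurable_rV.
- apply: intgZ; apply: intg_indic; last exact: lebesgue_rV_norm_le_fin.
  exact: (closed_measurable_rV (@closed_norm_le R N M)).
- move=> x; rewrite indicE; have [xM|/fM ->] := leP `|x| M.
    by rewrite mem_set// mulr1.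
  by rewrite normr0 mulr_ge0.
Qed.

Lemma bounded_support_unif f (eps : R) : continuous f -> bounded_support f -> 0 < eps ->
  exists2 d : R, 0 < d & forall x y, `|x - y| < d -> `|f x - f y| <= eps.
Proof.
move=> cf [M fM] e0.
pose P (d : R) (x : 'rV[R]_N) := forall y, `|x - y| < d -> `|f x - f y| <= eps.
(* Compactness in covering form, for the filter of radii [d] tending to 0. The ball is enlarged by 1
   so that, for [d < 1], a point outside it and any point within [d] of it both lie off the
   support. *)
have : \forall d \near 0^'+, [set x : 'rV[R]_N | `|x| <= M + 1] `<=` P d.
  have /compact_near_coveringP cov := @compact_norm_le (M + 1).
  apply: (cov R (0 : R)^'+ P) => x _.
  have /cvgrPdist_lt /(_ (eps / 2)) := cf x.
  rewrite divr_gt0// => /(_ isT) /nbhs_normP[r /= r0 xr].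
  have r20 : 0 < r / 2 by rewrite divr_gt0.
  have xr2 : \forall x' \near x, `|x - x'| < r / 2.
    by have /cvgrPdist_lt := @cvg_id _ (nbhs x); apply.
  near=> x' d => y x'y.
  have xx' : `|x - x'| < r / 2.
    by near: x'; exact: xr2.
  have dr : d < r / 2 by near: d; exact: nbhs_right_lt.
  have f1 : `|f x - f x'| < eps / 2.
    by apply: xr; rewrite /= (lt_le_trans xx')// ler_pdivrMr// ler_pMr// ler1n.
  have f2 : `|f x - f y| < eps / 2.
    apply: xr; rewrite /= -(subrKA x') (le_lt_trans (ler_normD _ _))//.
    by rewrite [ltRHS]splitr ltrD// (lt_trans x'y).
  rewrite -(subrKA (f x)) (le_trans (ler_normD _ _))// [leRHS]splitr lerD// ltW//.
  by rewrite distrC.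
move=> h.
have [d [[d0 d1] Pd]] : exists d : R, (0 < d /\ d < 1) /\
    [set x : 'rV[R]_N | `|x| <= M + 1] `<=` P d.
  near (0 : R)^'+ => d; exists d; split; [split|by near: d].
    by near: d; exact: nbhs_right_gt.
  by near: d; exact: nbhs_right_lt.
exists d => // x y xy; have [xM|Mx] := leP `|x| (M + 1); first exact: Pd.
have My : M < `|y|.
  rewrite -(ltrD2r 1) (lt_le_trans Mx)// -[x](subrK y) (le_trans (ler_normD _ _))//.
  by rewrite addrC lerD2l ltW// (lt_trans xy).
by rewrite !fM ?subrr ?normr0 ?(ltW e0)// (lt_trans _ Mx)// ltrDl.
Unshelve. all: by end_near. Qed.

Lemma norm_basis_le i : `|e i| <= 1.
Proof.
apply/le_rV_norm => // j; rewrite mxE eqxx/=.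
by case: (_ == _); rewrite ?normr1// normr0.
Qed.

(** By the mean value theorem the error is [h] times an oscillation of [partial i f], which is
    uniformly small. Uniformity in [x] is what allows the estimate to be integrated. *)
Lemma diff_quotient_unif f i (eps : R) : is_Ck 1 setT f -> bounded_support f ->
  0 < eps -> exists2 d : R, 0 < d & forall h x, `|h| < d ->
  `|f (h *: e i + x) - f x - h * partial i f x| <= eps * `|h|.
Proof.
move=> f1 bf e0.
have [d d0 unif] := bounded_support_unif (is_Ck_continuous (is_Ck_partial i f1))
  (bounded_support_partial i bf) e0.
exists d => // h x hd.
have [t th ->] := MVT_dir x h (fun y => is_Ck_is_derive i y f1).
rewrite [X in `|_ - X|]mulrC -mulrBl normrM ler_wpM2r//; apply: unif.
rewrite addrK normrZ (le_lt_trans _ hd)// -[leRHS]mulr1 ler_pM//.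
exact: norm_basis_le.
Qed.

Lemma ge0_integral_translate (f : 'rV[R]_N -> \bar R) c :
  measurable_fun setT f -> (forall x, (0 <= f x)%E) ->
  (\int[leb]_x f (x + c)%R = \int[leb]_x f x)%E.
Proof.
move=> mf f0.
have := @ge0_integral_pushforward _ _ _ _ R _ (measurable_translate c) leb setT f.
rewrite preimage_setT => <- //.
apply: eq_measure_integral; first exact: measurable_translate.
by move=> m A mA _; exact: lebesgue_rV_translate.
Qed.

Lemma intg_translate f c : intg f -> intg (fun x => f (x + c)).
Proof.
move=> fi; have mf := intg_measurable fi; apply/integrableP; split.
  apply/measurable_EFinP.
  exact: (measurableT_comp mf (measurable_translate c)).
have /integrableP[_] := fi.
rewrite -(@ge0_integral_translate (fun x => `|(f x)%:E|)%E c)//.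
by apply: measurableT_comp => //; exact/measurable_EFinP.
Qed.

Lemma Rintegral_translate f c : intg f ->
  \int[leb]_x f (x + c) = \int[leb]_x f x.
Proof.
move=> fi; have mf := intg_measurable fi; congr fine.
have := @integral_pushforward _ _ _ _ R _ (measurable_translate c) leb setT
  (EFin \o f).
rewrite preimage_setT => <- //.
- apply: eq_measure_integral; first exact: measurable_translate.
  by move=> m A mA _; exact: lebesgue_rV_translate.
- exact/measurable_EFinP.
- exact: intg_translate.
Qed.

(** No iterated integration is used: by translation invariance the increment
    [f (h *: e i + x) - f x] has integral 0 for every [h], and divided by [h] it is uniformly close
    to [partial i f] on a fixed ball of volume [V], off which everything vanishes. *)
Lemma Rintegral_partial f i : is_Ck 1 setT f -> bounded_support f ->
  \int[leb]_x partial i f x = 0.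
Proof.
move=> f1 /[dup] bf [M fM].
have g0 := is_Ck_continuous (is_Ck_partial i f1).
have bg := bounded_support_partial i bf.
have fi := bounded_support_intg (is_Ck_continuous f1) bf.
have gi := bounded_support_intg g0 bg.
pose A := [set x : 'rV[R]_N | `|x| <= M + 1].
have Ai : intg (fun x => \1_A x).
  apply: intg_indic; last exact: lebesgue_rV_norm_le_fin.
  exact: (closed_measurable_rV (@closed_norm_le R N (M + 1))).
set V := \int[leb]_x \1_A x.
have V0 : 0 <= V by apply: Rintegral_ge0 => x _.
suff h eps : 0 < eps -> `|\int[leb]_x partial i f x| <= eps * V.
  apply/eqP; rewrite -normr_le0; apply/ler_addgt0Pr => eps eps0.
  have V1 : 0 < V + 1 by rewrite ltr_wpDl.
  rewrite add0r (le_trans (h _ (divr_gt0 eps0 V1)))//.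
  by rewrite -mulrA ler_piMr ?(ltW eps0)// ler_pdivrMl// mulr1 lerDl.
move=> eps0.
have [d d0 fd] := diff_quotient_unif i f1 bf eps0.
(* The bound [h <= 1] keeps the translated support inside [A]. *)
pose h := Num.min (d / 2) 1.
have h0 : 0 < h by rewrite lt_min divr_gt0/=.
have hd : `|h| < d by rewrite gtr0_norm// gt_min ltr_pdivrMr// ltr_pMr// ltr1n.
have h1 : `|h| <= 1 by rewrite gtr0_norm// ge_min lexx orbT.
have fhi : intg (fun x => f (h *: e i + x)).
  by under eq_fun do rewrite addrC; exact: intg_translate.
have E : \int[leb]_x (f (h *: e i + x) - f x - h * partial i f x) =
    - (h * \int[leb]_x partial i f x).
  rewrite RintegralB//; [|exact: intgB|exact: intgZ].
  rewrite RintegralB//.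
  under [X in X - _ - _]eq_Rintegral do rewrite addrC.
  by rewrite Rintegral_translate// subrr sub0r RintegralZl.
have : `|h * \int[leb]_x partial i f x| <= h * (eps * V).
  rewrite -normrN -E /V -!RintegralZl//; [|exact: intgZ].
  apply: normr_Rintegral_le => [||x].
  - by apply: intgB; [exact: intgB|exact: intgZ].
  - by do 2 apply: intgZ.
  rewrite indicE; have [xM|xM] := leP `|x| (M + 1).
    by rewrite mem_set// mulr1 [leRHS]mulrC; have := fd h x hd; rewrite (gtr0_norm h0).
  have Mx : M < `|x| by rewrite (lt_trans _ xM)// ltrDl.
  rewrite memNset/=; last by rewrite /A/= leNgt xM.
  rewrite (fM x)// (partial_near0 (f := f)); last first.
    by near=> y; apply: fM; near: y; exact: near_norm_gt.
  rewrite fM ?subrr ?mulr0 ?subrr ?normr0//.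
  rewrite -(ltrD2r 1) (lt_le_trans xM)// -{1}[x](addKr (h *: e i)).
  rewrite addrC (le_trans (ler_normB _ _))// lerD2l normrZ -[leRHS]mulr1.
  by rewrite ler_pM// norm_basis_le.
by rewrite normrM (gtr0_norm h0) ler_pM2l.
Unshelve. all: by end_near. Qed.

End compact_support.

(** * Regularity and translations in L^1 *)

Section regularity.
Context {R : realType} {N : nat} (m : {finite_measure set 'rV[R]_N -> \bar R}).
Local Open Scope ereal_scope.

(** Inner and outer approximation are imposed together: the property then passes to complements, and
    the regular sets form a sigma-algebra containing the open sets. *)
Definition regular_set (A : set 'rV[R]_N) := forall eps : R, (0 < eps)%R ->
  exists F G, [/\ closed F, open G, F `<=` A, A `<=` G & m (G `\` F) <= eps%:E].

Lemma measure_small_decreasing (B : (set 'rV[R]_N)^nat) (eps : R) :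
  (forall n, measurable (B n)) -> \bigcap_n B n = set0 ->
  {homo B : i j / (i <= j)%N >-> (j <= i)%O} -> (0 < eps)%R ->
  exists n, m (B n) <= eps%:E.
Proof.
move=> mB B0 dB eps0.
have : m \o B @ \oo --> m (\bigcap_n B n).
  apply: nonincreasing_cvg_mu => //; first by rewrite -ge0_fin_numE// fin_num_measure.
  by rewrite B0.
rewrite B0 measure0 => /fine_cvgP[_] /cvgrPdist_le /(_ _ eps0)[n _ /(_ n (leqnn n))].
rewrite sub0r normrN => h; exists n.
rewrite -(fineK (fin_num_measure m _ (mB n))) lee_fin.
by rewrite (le_trans _ h)// ler_norm.
Qed.

Lemma regular_open (U : set 'rV[R]_N) : open U -> regular_set U.
Proof.
move=> oU eps eps0.
(* The points at distance at least [1 / (n + 1)] from the complement: closed sets that exhaust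
   [U]. *)
pose F n := \bigcap_(y in ~` U) [set x : 'rV[R]_N | (n.+1%:R^-1 <= `|x - y|)%R].
have cF n : closed (F n).
  apply: closed_bigI => y _.
  apply: (@closed_comp _ _ (fun x : 'rV[R]_N => `|x - y|%R) [set t : R | (n.+1%:R^-1 <= t)%R]).
    move=> x _; apply: (@continuous_comp _ _ _ (fun z : 'rV[R]_N => z - y)%R (fun z => `|z|%R)).
      by apply: (@continuousB _ _ _ id (cst y)); [exact: cvg_id|exact: cst_continuous].
    exact: norm_continuous.
  exact: closed_ge.
have FU n : F n `<=` U.
  move=> x Fx; apply: contrapT => Ux; have := Fx x Ux.
  by rewrite /= subrr normr0 leNgt invr_gt0 ltr0n.
have [||||n hn] := @measure_small_decreasing (fun n => U `\` F n) eps.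
- move=> n; apply: measurableD; first exact: open_measurable_rV.
  exact: closed_measurable_rV.
- apply/seteqP; split => // x Ux.
  have [Ux0 _] := Ux 0%N Logic.I.
  have : nbhs x U by exact: open_nbhs_nbhs.
  move=> /nbhs_normP[r /= r0 xr].
  have [n nr] : exists n : nat, (n.+1%:R^-1 < r)%R.
    by have := near_infty_natSinv_lt (PosNum r0) => -[n _ /(_ n (leqnn n))]; exists n.
  have [_ []] := Ux n Logic.I.
  move=> y Uy; rewrite /= leNgt; apply/negP => xy; apply: Uy; apply: xr => /=.
  exact: (lt_trans xy).
- move=> i j ij; apply/subsetPset => x [Ux nFx]; split => // Fx; apply: nFx => y Uy.
  apply: (le_trans _ (Fx y Uy)).
  by rewrite lef_pV2 ?posrE ?ltr0n// ler_nat ltnS.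
- exact: eps0.
by exists (F n), U; split.
Qed.

Lemma regular_setC (A : set 'rV[R]_N) : regular_set A -> regular_set (~` A).
Proof.
move=> rA eps /rA [F [G [cF oG FA AG GF]]]; exists (~` G), (~` F); split.
- exact: open_closedC.
- exact: closed_openC.
- exact: subsetC.
- exact: subsetC.
- by rewrite setDE setCK setIC -setDE.
Qed.

Lemma regular_bigcup (A : (set 'rV[R]_N)^nat) : (forall n, regular_set (A n)) ->
  regular_set (\bigcup_n A n).
Proof.
move=> rA eps eps0.
have e2 : (0 < eps / 2)%R by rewrite divr_gt0.
have en n : (0 < (eps / 2) / (2 ^ n.+1)%:R)%R.
  by rewrite divr_gt0// ltr0n expn_gt0.
have /choice[F /choice[G FG]] := fun n => rA n _ (en n).
have cF n : closed (F n) by have [] := FG n.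
have oG n : open (G n) by have [] := FG n.
have FA n : F n `<=` A n by have [] := FG n.
have AG n : A n `<=` G n by have [] := FG n.
have GF n : m (G n `\` F n) <= ((eps / 2) / (2 ^ n.+1)%:R)%:E by have [] := FG n.
have mF n : measurable (F n) by exact: closed_measurable_rV.
have mG n : measurable (G n) by exact: open_measurable_rV.
have mUF : measurable (\bigcup_n F n) by exact: bigcupT_measurable.
have mUG : measurable (\bigcup_n G n) by exact: bigcupT_measurable.
pose S n := \big[setU/set0]_(i < n) F i.
have mS n : measurable (S n) by apply: bigsetU_measurable.
have cS n : closed (S n) by apply: closed_bigsetU => i _; exact: cF.
(* A countable union of closed sets need not be closed, so only the first [K] are kept, at the cost
   of [eps / 2]; the other [eps / 2] is spread geometrically over the sets [G n] minus [F n]. *)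
have [||||K hK] := @measure_small_decreasing
  (fun n => (\bigcup_n F n) `\` S n) (eps / 2).
- by move=> n; exact: measurableD.
- apply/seteqP; split => // x Ux.
  have [[n _ Fx] _] := Ux 0%N Logic.I.
  have [_ []] := Ux n.+1 Logic.I.
  by rewrite /S -bigcup_mkord; exists n => /=.
- move=> i j ij; apply/subsetPset => x [UFx nSx]; split => // Sx; apply: nSx.
  move: Sx; rewrite /S -!bigcup_mkord => -[k /= ki Fk]; exists k => //=.
  exact: leq_trans ij.
- exact: e2.
exists (S K), (\bigcup_n G n); split.
- exact: cS.
- exact: bigcup_open.
- by move=> x; rewrite /S -bigcup_mkord => -[k _ Fk]; exists k => //; exact: FA.
- by move=> x [k _ Ak]; exists k => //; exact: AG.
apply: (@le_trans _ _ (m ((\bigcup_n (G n `\` F n)) `|` ((\bigcup_n F n) `\` S K)))).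
  apply: le_measure; rewrite ?inE.
  - exact: measurableD.
  - apply: measurableU; last exact: measurableD.
    by apply: bigcupT_measurable => n; exact: measurableD.
  - move=> x [[k _ Gk] nS]; have [[i _ Fi]|nF] := pselect ((\bigcup_n F n) x).
      by right; split=> //; exists i.
    by left; exists k => //; split=> // Fk; apply: nF; exists k.
apply: (le_trans (measureU2 _ _ _)).
- by apply: bigcupT_measurable => n; exact: measurableD.
- exact: measurableD.
rewrite [eps](splitr eps) EFinD leeD//.
apply: (le_trans _ (epsilon_trick0 xpredT (ltW e2))).
apply: (@le_trans _ _ (\sum_(i <oo) m (G i `\` F i))).
  apply: measure_sigma_subadditive => //.
  - by move=> i; exact: measurableD.
  - by apply: bigcupT_measurable => n; exact: measurableD.
by apply: lee_nneseries => // i _.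
Qed.

Lemma measurable_regular (A : set 'rV[R]_N) : measurable A -> regular_set A.
Proof.
apply: smallest_sub; last by move=> U oU; exact: regular_open.
split => [|B|B].
- by apply: regular_open; exact: open0.
- by rewrite setTD; exact: regular_setC.
- exact: regular_bigcup.
Qed.

End regularity.

Lemma compact_thickening {R : realType} {N : nat} (K U : set 'rV[R]_N) :
  compact K -> open U -> K `<=` U ->
  exists2 d : R, 0 < d & forall x y, K x -> `|x - y| < d -> U y.
Proof.
move=> cK oU KU; pose P (d : R) (x : 'rV[R]_N) := forall y, `|x - y| < d -> U y.
have h : \forall d \near 0^'+, K `<=` P d.
  move/compact_near_coveringP : cK => cov.
  apply: (cov R (0 : R)^'+ P) => x Kx.
  have : nbhs x U by apply: open_nbhs_nbhs; split=> //; exact: KU.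
  move=> /nbhs_normP[r /= r0 xr].
  have r20 : 0 < r / 2 by rewrite divr_gt0.
  have xr2 : \forall x' \near x, `|x - x'| < r / 2.
    by have /cvgrPdist_lt := @cvg_id _ (nbhs x); apply.
  near=> x' d => y x'y; apply: xr => /=.
  have xx' : `|x - x'| < r / 2 by near: x'; exact: xr2.
  have dr : d < r / 2 by near: d; exact: nbhs_right_lt.
  rewrite -(subrKA x') (le_lt_trans (ler_normD _ _))//.
  by rewrite [ltRHS]splitr ltrD// (lt_trans x'y).
near (0 : R)^'+ => d; exists d; first by near: d; exact: nbhs_right_gt.
have Pd : K `<=` P d by near: d.
by move=> x y Kx; exact: Pd.
Unshelve. all: by end_near. Qed.

(** * Continuity of translations in L^1 *)

Section L1_translation.
Context {R : realType} {N : nat}.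
Implicit Types f g w : 'rV[R]_N -> R.
Local Notation leb := (lebesgue_rV R N).
Local Notation intg f := (leb.-integrable [set: 'rV[R]_N] (EFin \o f)).

Definition L1_continuous f := forall eps : R, 0 < eps ->
  exists2 d : R, 0 < d &
    forall z, `|z| < d -> \int[leb]_x `|f (x + z) - f x| <= eps.

Lemma intg_translateB f z : intg f -> intg (fun x => `|f (x + z) - f x|).
Proof. by move=> fi; apply: intg_norm; apply: intgB => //; exact: intg_translate. Qed.

Lemma L1_continuousD f g : intg f -> intg g -> L1_continuous f -> L1_continuous g ->
  L1_continuous (fun x => f x + g x).
Proof.
move=> fi gi cf cg eps eps0; have e2 : 0 < eps / 2 by rewrite divr_gt0.
have [d1 d10 h1] := cf _ e2; have [d2 d20 h2] := cg _ e2.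
exists (Num.min d1 d2); first by rewrite lt_min d10.
move=> z; rewrite lt_min => /andP[z1 z2].
rewrite [eps]splitr; apply: le_trans (lerD (h1 z z1) (h2 z z2)).
rewrite -RintegralD//; [|exact: intg_translateB..].
apply: le_Rintegral => //.
- by apply: intg_translateB; exact: intgD.
- by apply: intgD; exact: intg_translateB.
- move=> x _; apply: le_trans (ler_normD _ _).
  by rewrite opprD addrACA.
Qed.

Lemma L1_continuousZ (k : R) f : intg f -> L1_continuous f ->
  L1_continuous (fun x => k * f x).
Proof.
move=> fi cf eps eps0; have k1 : 0 < `|k| + 1 by rewrite ltr_wpDl.
have [d d0 h] := cf _ (divr_gt0 eps0 k1).
exists d => // z /h {}h.
have -> : \int[leb]_x `|k * f (x + z) - k * f x| =
    `|k| * \int[leb]_x `|f (x + z) - f x|.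
  rewrite -RintegralZl//; last exact: intg_translateB.
  by apply: eq_Rintegral => x _; rewrite -mulrBr normrM.
apply: (@le_trans _ _ ((`|k| + 1) * (eps / (`|k| + 1)))); last first.
  by rewrite mulrCA divff ?mulr1// gt_eqF.
apply: ler_pM => //; first by apply: Rintegral_ge0.
by rewrite lerDl.
Qed.

Lemma L1_continuous_sum I (r : seq I) (F : I -> 'rV[R]_N -> R) :
  (forall i, intg (F i)) -> (forall i, L1_continuous (F i)) ->
  L1_continuous (fun x => \sum_(i <- r) F i x).
Proof.
move=> Fi Fc; elim: r => [|i r IH].
  under eq_fun do rewrite big_nil; move=> eps eps0; exists 1 => // z _.
  under eq_Rintegral do rewrite subrr normr0.
  by rewrite /Rintegral integral0 ltW.
under eq_fun do rewrite big_cons; apply: L1_continuousD => //.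
exact: intg_sum.
Qed.

Lemma L1_continuous_lim f : intg f ->
  (forall eps : R, 0 < eps ->
    exists g, [/\ intg g, L1_continuous g & \int[leb]_x `|f x - g x| <= eps]) ->
  L1_continuous f.
Proof.
move=> fi fg eps eps0; have e3 : 0 < eps / 3 by rewrite divr_gt0.
have [g [gi gc fge]] := fg _ e3; have [d d0 h] := gc _ e3.
exists d => // z /h {}h.
have fgi : intg (fun x => `|f x - g x|) by apply: intg_norm; exact: intgB.
have fgti : intg (fun x => `|f (x + z) - g (x + z)|) by exact: (intg_translate z fgi).
have gg : intg (fun x => `|g (x + z) - g x|) by exact: intg_translateB.
apply: (@le_trans _ _ (\int[leb]_x (`|f (x + z) - g (x + z)| +
   `|g (x + z) - g x| + `|f x - g x|))).
  apply: le_Rintegral => //; first exact: intg_translateB.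
    by apply: intgD => //; exact: intgD.
  move=> x _; rewrite [`|f x - g x|]distrC; apply: le_trans (lerD (ler_normD _ _) (lexx _)).
  apply: le_trans (ler_normD _ _); rewrite le_eqVlt; apply/orP; left; apply/eqP.
  congr (`|_|); ring.
rewrite !RintegralD//; last exact: intgD.
rewrite (Rintegral_translate z fgi).
have -> : eps = eps / 3 + eps / 3 + eps / 3 by field.
by rewrite !lerD.
Qed.

(** Enclose [A] between a compact [F] and an open [G'] with [D = G' - F] of small measure. If [z] is
    shorter than the distance by which [F] can be thickened inside [G'], then whenever exactly one
    of [x], [x + z] lies in [A], one of the two lies in [D]. Hence the difference of indicators is
    at most [1_D (x + z) + 1_D x]. *)
Lemma L1_continuous_indic (A : set 'rV[R]_N) (M : R) : measurable A ->
  (forall x, A x -> `|x| <= M) -> L1_continuous (fun x => \1_A x).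
Proof.
move=> mA AM eps eps0.
pose B := [set x : 'rV[R]_N | `|x| <= M + 1].
have mB : measurable B by exact: (closed_measurable_rV (@closed_norm_le R N (M + 1))).
have Boo : (leb B < +oo)%E by exact: lebesgue_rV_norm_le_fin.
(* Regularity is available for finite measures, so the Lebesgue measure is restricted to a ball
   larger than the one containing [A]. Cutting [G] by the open ball of that radius keeps it open. *)
pose m : {finite_measure set 'rV[R]_N -> \bar R} := mfrestr mB Boo.
have e2 : 0 < eps / 2 by rewrite divr_gt0.
have [F [G [cF oG FA AG mGF]]] := measurable_regular m mA e2.
pose G' := G `&` [set x : 'rV[R]_N | `|x| < M + 1].
have oG' : open G'.
  apply: openI => //; apply: (@open_comp _ _ (fun x : 'rV[R]_N => `|x|) [set t : R | t < M + 1]).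
    by move=> x _; exact: norm_continuous.
  exact: open_lt.
have AG' : A `<=` G'.
  by move=> x Ax; split; [exact: AG|rewrite /= (le_lt_trans (AM x Ax))// ltrDl].
have FB : F `<=` [set x : 'rV[R]_N | `|x| <= M] by move=> x /FA /AM.
have cpF : compact F by apply: subclosed_compact FB => //; exact: compact_norm_le.
have [d d0 Fd] := compact_thickening cpF oG' (subset_trans FA AG').
have mF : measurable F by exact: closed_measurable_rV.
have mG' : measurable G' by exact: open_measurable_rV.
have mG : measurable G by exact: open_measurable_rV.
pose D := G' `\` F.
have mD : measurable D by exact: measurableD.
have DB : (leb D <= (eps / 2)%:E)%E.
  apply: le_trans mGF; rewrite /= /mfrestr /mrestr.
  apply: le_measure; rewrite ?inE//.
    by apply: measurableI => //; exact: measurableD.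
  by move=> x [[Gx xM] nFx]; split; [split|exact: ltW].
have Dfin : (leb D < +oo)%E by rewrite (le_lt_trans DB)// ltry.
have Di : intg (fun x => \1_D x) by exact: intg_indic.
have Dint : \int[leb]_x \1_D x <= eps / 2.
  rewrite -lee_fin EFin_Rintegral// integral_indic// setIT//.
have Ai : intg (fun x => \1_A x).
  apply: intg_indic => //; apply: (le_lt_trans _ Boo); apply: le_measure; rewrite ?inE//.
  by move=> x /AM xM; rewrite /B/= (le_trans xM)// lerDl.
exists d => // z zd.
apply: (@le_trans _ _ (\int[leb]_x (\1_D (x + z) + \1_D x))); last first.
  rewrite RintegralD//; last exact: (intg_translate z Di).
  by rewrite (Rintegral_translate z Di) [leRHS]splitr lerD.
apply: le_Rintegral => //; first exact: intg_translateB.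
  by apply: intgD => //; exact: (intg_translate z Di).
move=> x _; rewrite !indicE.
have ind (P : bool) : (0 : R) <= P%:R by [].
have [Ax|Ax] := boolP (x \in A); have [Axz|Axz] := boolP (x + z \in A);
  rewrite ?subrr ?normr0 ?addr_ge0//= ?sub0r ?subr0 ?normrN ?normr1.
- move: Ax Axz; rewrite inE notin_setE => Ax Axz.
  have [Fx|Fx] := pselect (F x).
    rewrite (mem_set (_ : D (x + z))) ?lerDl//; split; last by move/FA.
    by apply: (Fd x) => //; rewrite opprD addrA subrr sub0r normrN.
  by rewrite [X in _ + (nat_of_bool X)%:R]mem_set ?lerDr//; split => //; exact: AG'.
- move: Ax Axz; rewrite inE notin_setE => Ax Axz.
  have [Fx|Fx] := pselect (F (x + z)).
    rewrite [X in _ + (nat_of_bool X)%:R]mem_set ?lerDr//; split; last by move/FA.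
    by apply: (Fd (x + z)) => //; rewrite addrAC subrr add0r.
  by rewrite (mem_set (_ : D (x + z))) ?lerDl//; split => //; exact: AG'.
Qed.

Import HBSimple.

(** Simple functions are dense in L^1 of the ball, and each is a finite combination of indicators of
    sets of finite measure; [L1_continuous_lim] passes to the limit. *)
Lemma intg_L1_continuous w (M : R) : intg w -> (forall x, M < `|x| -> w x = 0) ->
  L1_continuous w.
Proof.
move=> wi wM; apply: L1_continuous_lim => // eps eps0.
pose B := [set x : 'rV[R]_N | `|x| <= M].
have mB : measurable B by exact: (closed_measurable_rV (@closed_norm_le R N M)).
have wiB : leb.-integrable B (EFin \o w) by apply: integrableS wi.
have [g_ [gi _ glim]] := approximation_sfun_integrable mB wiB.
move/fine_cvgP : glim => [gfin /cvgrPdist_le /(_ _ eps0)] glim.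
have [n [nfin nle]] : exists n,
    (\int[leb]_(z in B) `|(EFin \o w) z - (g_ n z)%:E|)%E \is a fin_num /\
    fine (\int[leb]_(z in B) `|(EFin \o w) z - (g_ n z)%:E|)%E <= eps.
  near \oo => n; exists n; split; first by near: n; exact: gfin.
  apply: (le_trans (ler_norm _)); rewrite -normrN -sub0r; near: n; exact: glim.
pose g := g_ n.
have fg : finite_set (range g) by exact: fimfunP.
pose F (y : R) x := y * \1_(g @^-1` [set y] `&` B) x.
have mgy y : measurable (g @^-1` [set y]).
  by rewrite -[X in measurable X]setTI; exact: measurable_funP.
have Fi y : intg (F y).
  apply: intgZ; apply: intg_indic; first exact: measurableI.
  apply: (le_lt_trans _ (@lebesgue_rV_norm_le_fin R N M)); apply: le_measure; rewrite ?inE//.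
  exact: measurableI.
have E : g \_ B = (fun x => \sum_(y <- finmap.enum_fset (fset_set (range g))) F y x).
  apply/funext => x; rewrite patchE; have [Bx|Bx] := boolP (x \in B).
    rewrite fimfunE fsbig_finite//=; apply: eq_bigr => y _.
    by rewrite /F !indicE in_setI Bx andbT.
  rewrite big1// => y _; rewrite /F indicE in_setI (negbTE Bx) andbF mulr0//.
exists (g \_ B); split.
- by rewrite E; exact: intg_sum.
- rewrite E; apply: L1_continuous_sum => // y; apply: L1_continuousZ.
    apply: intg_indic; first exact: measurableI.
    apply: (le_lt_trans _ (@lebesgue_rV_norm_le_fin R N M)); apply: le_measure; rewrite ?inE//.
    exact: measurableI.
  by apply: (@L1_continuous_indic _ M) => [|x []//]; exact: measurableI.
- apply: le_trans nle; rewrite /Rintegral [X in _ <= fine X]integral_mkcond.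
  rewrite le_eqVlt; apply/orP; left; apply/eqP; congr fine.
  apply: eq_integral => x _; rewrite !patchE; case: ifPn => //.
  rewrite notin_setE /B/= => /negP; rewrite -ltNge => /wM ->.
  by rewrite subrr normr0.
Unshelve. all: by end_near. Qed.

End L1_translation.

(** * Mollification *)

Lemma is_derive_bound {R : realType} {V : normedModType R} (f : V -> R) x v (l : R) :
  (forall eps : R, 0 < eps -> exists2 d : R, 0 < d & forall h : R, `|h| < d ->
    `|f (h *: v + x) - f x - h * l| <= eps * `|h|) ->
  is_derive x v f l.
Proof.
move=> fl.
have lim : (fun h : R => h^-1 *: ((f \o shift x) (h *: v) - f x)) @ 0^' --> l.
  apply/cvgrPdist_le => eps eps0; have [d d0 hd] := fl _ eps0.
  near=> h.
  have h0 : h != 0 by near: h; exact: nbhs_dnbhs_neq.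
  have hlt : `|h| < d.
    near: h; apply: dnbhs0_lt => //.
  rewrite distrC /=.
  have -> : h^-1 *: (f (h *: v + x) - f x) - l = h^-1 * (f (h *: v + x) - f x - h * l).
    by rewrite mulrBr mulKf.
  rewrite normrM normfV ler_pdivrMl ?normr_gt0// [leRHS]mulrC; exact: hd.
by apply: DeriveDef; [apply/cvg_ex; exists l|exact/cvg_lim].
Unshelve. all: by end_near. Qed.

Section convolution.
Context {R : realType} {N : nat}.
Implicit Types f g w : 'rV[R]_N -> R.
Local Notation leb := (lebesgue_rV R N).
Local Notation intg f := (leb.-integrable [set: 'rV[R]_N] (EFin \o f)).
Local Notation e i := (delta_mx ord0 i : 'rV[R]_N).

(* The convolution of [w] with the reflection of [f]. *)
Definition conv w f x := \int[leb]_y (w y * f (y - x)).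

Lemma conv_intg w f x : intg w -> continuous f -> bounded_support f ->
  intg (fun y => w y * f (y - x)).
Proof.
move=> wi cf bf; have [C C0 fC] := bounded_support_bounded cf bf.
apply: (@intgM_bounded _ _ _ leb _ _ C) => //.
exact: (measurableT_comp (continuous_measurable_rV cf) (measurable_translate (- x))).
Qed.

Lemma conv_continuous w f : intg w -> continuous f -> bounded_support f ->
  continuous (conv w f).
Proof.
move=> wi cf bf x; suff : conv w f @ x --> conv w f x by [].
have FF : Filter (nbhs x) by exact: nbhs_filter.
apply: ((@cvgrPdist_le _ _ _ (nbhs x) FF (conv w f) (conv w f x)).2) => eps eps0.
pose W := \int[leb]_y `|w y|.
have W0 : 0 <= W by apply: Rintegral_ge0.
have W1 : 0 < W + 1 by rewrite ltr_wpDl.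
have [d d0 unif] := bounded_support_unif cf bf (divr_gt0 eps0 W1).
near=> z.
have xz : `|x - z| < d.
  by near: z; have /cvgrPdist_lt := @cvg_id _ (nbhs x); apply.
rewrite /conv -RintegralB//; [|exact: conv_intg..].
apply: (@le_trans _ _ (\int[leb]_y (eps / (W + 1) * `|w y|))).
  apply: normr_Rintegral_le => [||y].
  - by apply: intgB; exact: conv_intg.
  - by apply: intgZ; exact: intg_norm.
  - rewrite -mulrBr normrM mulrC ler_wpM2r//; apply: unif.
    by rewrite opprB addrC addrA subrK distrC.
rewrite RintegralZl//; last exact: intg_norm.
by rewrite -/W -mulrA ler_piMr ?(ltW eps0)// ler_pdivrMl// mulr1 lerDl.
Unshelve. all: by end_near. Qed.

(** The minus sign comes from the reflection: [x] enters through [y - x], so the increment of the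
    argument is [- h]. Two derivatives restore the sign, whence [laplacian_conv]. *)
Lemma conv_is_derive w f i x : intg w -> is_Ck 1 setT f -> bounded_support f ->
  is_derive x (e i) (conv w f) (- conv w (partial i f) x).
Proof.
move=> wi f1 bf; apply: is_derive_bound => eps eps0.
have cf := is_Ck_continuous f1.
have cg := is_Ck_continuous (is_Ck_partial i f1).
have bg := bounded_support_partial i bf.
pose W := \int[leb]_y `|w y|.
have W0 : 0 <= W by apply: Rintegral_ge0.
have W1 : 0 < W + 1 by rewrite ltr_wpDl.
have [d d0 unif] := diff_quotient_unif i f1 bf (divr_gt0 eps0 W1).
exists d => // h hd.
have -> : conv w f (h *: e i + x) - conv w f x - h * (- conv w (partial i f) x) =
  \int[leb]_y (w y * f (y - (h *: e i + x)) - w y * f (y - x)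
    - (- h) * (w y * partial i f (y - x))).
  rewrite RintegralB//; last first.
  - by apply: intgZ; exact: conv_intg.
  - by apply: intgB; exact: conv_intg.
  rewrite RintegralB//; [|exact: conv_intg..].
  by rewrite RintegralZl ?mulNr ?mulrN//; exact: conv_intg.
apply: (@le_trans _ _ (\int[leb]_y (eps / (W + 1) * `|h| * `|w y|))).
  apply: normr_Rintegral_le => [||y].
  - apply: intgB; first by apply: intgB; exact: conv_intg.
    by apply: intgZ; exact: conv_intg.
  - by apply: intgZ; exact: intg_norm.
  - rewrite mulrCA -!mulrBr normrM mulrC ler_wpM2r//.
    have -> : y - (h *: e i + x) = (- h) *: e i + (y - x).
      by rewrite opprD scaleNr addrCA addrA.
    by have := unif (- h) (y - x); rewrite normrN; apply.
rewrite RintegralZl//; last exact: intg_norm.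
rewrite -/W mulrAC ler_wpM2r//.
by rewrite -mulrA ler_piMr ?(ltW eps0)// ler_pdivrMl// mulr1 lerDl.
Qed.

Lemma is_C2_conv w f : intg w -> is_Ck 2 setT f -> bounded_support f ->
  is_Ck 2 setT (conv w f).
Proof.
move=> wi f2 bf.
apply: (@is_Ck_intro _ _ 1 _ (fun i x => - conv w (partial i f) x)) => [|i x|i].
- by apply: conv_continuous => //; exact: is_Ck_continuous f2.
- by apply: conv_is_derive => //; exact: is_CkS.
- apply: is_CkN.
  have fi1 := is_Ck_partial i f2; have bfi := bounded_support_partial i bf.
  apply: (@is_Ck_intro _ _ 0 _ (fun j x => - conv w (partial j (partial i f)) x)) => [|j x|j].
  + by apply: conv_continuous => //; exact: is_Ck_continuous fi1.
  + exact: conv_is_derive.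
  + apply: is_CkN; split=> // x _; apply: conv_continuous => //.
      exact: (is_Ck_continuous (is_Ck_partial j fi1)).
    exact: bounded_support_partial.
Qed.

Lemma laplacian_conv w f x : intg w -> is_Ck 2 setT f -> bounded_support f ->
  laplacian (conv w f) x = conv w (laplacian f) x.
Proof.
move=> wi f2 bf; rewrite /laplacian {2}/conv.
under eq_Rintegral do rewrite mulr_sumr.
have fi1 i := is_Ck_partial i f2; have bfi i := bounded_support_partial i bf.
rewrite Rintegral_sum; last first.
  move=> i; apply: conv_intg => //; first exact: (is_Ck_continuous (is_Ck_partial i (fi1 i))).
  exact: bounded_support_partial.
apply: eq_bigr => i _.
have -> : partial i (conv w f) = (fun x => - conv w (partial i f) x).
  apply/funext => y; apply: partial_val; apply: conv_is_derive => //; exact: is_CkS.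
apply: partial_val; rewrite -[X in is_derive _ _ _ X]opprK.
by apply: is_deriveN; exact: conv_is_derive.
Qed.

Lemma conv_translate w f x : intg w -> continuous f -> bounded_support f ->
  conv w f x = \int[leb]_z (w (z + x) * f z).
Proof.
move=> wi cf bf; rewrite /conv -(Rintegral_translate x (conv_intg x wi cf bf)).
by apply: eq_Rintegral => z _; rewrite addrK.
Qed.

(** As [f] has integral 1, [|conv w f x - w x|] is at most the integral of [|w (x + z) - w x| * f z]
    in [z]. Integrating in [x] and exchanging by Tonelli leaves an average of translation errors
    with [|z| < d], each at most [eps]. *)
Lemma conv_L1 w f (d eps : R) : intg w -> continuous f -> bounded_support f ->
  (forall x, 0 <= f x) -> (forall x, f x != 0 -> `|x| < d) ->
  \int[leb]_x f x = 1 ->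
  (forall z, `|z| < d -> \int[leb]_x `|w (x + z) - w x| <= eps) ->
  intg (conv w f) /\ \int[leb]_x `|conv w f x - w x| <= eps.
Proof.
move=> wi cf bf f0 fd f1 weps.
have fi := bounded_support_intg cf bf.
have mw := intg_measurable wi; have mf := continuous_measurable_rV cf.
have wzi x : intg (fun z => w (z + x) * f z).
  have := intg_translate x (conv_intg x wi cf bf).
  by apply: eq_integrable => // z _; rewrite /= addrK.
have mc : measurable_fun setT (conv w f).
  exact: (continuous_measurable_rV (conv_continuous wi cf bf)).
pose F (p : 'rV[R]_N * 'rV[R]_N) : \bar R := (`|w (p.2 + p.1) - w p.1| * f p.2)%:E.
have mF : measurable_fun setT F.
  apply/measurable_EFinP; apply: measurable_funM; last exact: measurableT_comp.
  apply: measurableT_comp => //; apply: measurable_funB; last exact: measurableT_comp.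
  apply: (measurableT_comp mw).
  under eq_fun do rewrite addrC; exact: measurable_rV_add.
have F0 p : (0 <= F p)%E by rewrite lee_fin mulr_ge0.
have le1 x : (`|conv w f x - w x|%:E <= \int[leb]_z F (x, z))%E.
  have gi : intg (fun z => w (z + x) * f z - w x * f z) by apply: intgB => //; exact: intgZ.
  have -> : conv w f x - w x = \int[leb]_z (w (z + x) * f z - w x * f z).
    rewrite RintegralB//; last exact: intgZ.
    by rewrite conv_translate// RintegralZl// f1 mulr1.
  apply: (@le_trans _ _ (\int[leb]_z `|w (z + x) * f z - w x * f z|)%:E).
    rewrite lee_fin; exact: le_normr_Rintegral.
  rewrite EFin_Rintegral; last exact: intg_norm.
  rewrite le_eqVlt; apply/orP; left; apply/eqP; apply: eq_integral => z _.
  by rewrite /F/= -mulrBl normrM (ger0_norm (f0 z)).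
have key : (\int[leb]_x (`|conv w f x - w x|%:E) <= eps%:E)%E.
  apply: (@le_trans _ _ (\int[leb]_x \int[leb]_z F (x, z))%E).
    apply: ge0_le_integral => //.
    - by apply/measurable_EFinP; apply: measurableT_comp => //; exact: measurable_funB.
    - exact: measurable_fun_fubini_tonelli_F.
  rewrite fubini_tonelli//.
  apply: (@le_trans _ _ (\int[leb]_z (eps * f z)%:E)%E); last first.
    rewrite -EFin_Rintegral; last exact: intgZ.
    by rewrite RintegralZl// f1 mulr1.
  apply: ge0_le_integral => //.
  - by move=> z _; exact: integral_ge0.
  - exact: measurable_fun_fubini_tonelli_G.
  - by apply/measurable_EFinP; apply: measurable_funM => //; exact: measurable_cst.
  move=> z _; have [fz|fz] := eqVneq (f z) 0.
    rewrite fz mulr0; under eq_integral do rewrite /F/= fz mulr0.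
    by rewrite integral0.
  rewrite /F/=.
  have ti : intg (fun x => `|w (x + z) - w x|) by exact: intg_translateB.
  have tfi : intg (fun x => `|w (x + z) - w x| * f z).
    by under eq_fun do rewrite mulrC; exact: intgZ.
  apply: (@le_trans _ _ (\int[leb]_x (`|w (x + z) - w x| * f z))%:E).
    rewrite (EFin_Rintegral tfi) le_eqVlt; apply/orP; left; apply/eqP.
    by apply: eq_integral => x _; rewrite /= [z + x]addrC.
  by rewrite lee_fin RintegralZr// ler_wpM2r// weps// fd.
have ci : intg (fun x => conv w f x - w x).
  apply/integrableP; split; first by apply/measurable_EFinP; exact: measurable_funB.
  by rewrite (le_lt_trans key)// ltry.
split.
  have := intgD ci wi; by under eq_fun do rewrite subrK.
by rewrite -lee_fin EFin_Rintegral//; exact: intg_norm.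
Qed.

End convolution.

(** * One-variable functions: the cube of the positive part and the convex function phi *)

Section real_functions.
Context {R : realType}.
Implicit Types (g : R -> R) (s t : R).

Lemma is_derive_derivable_continuous g g1 s : is_derive s 1 g (g1 s) ->
  {for s, continuous g}.
Proof.
move=> [dg _]; apply: differentiable_continuous; exact/derivable1_diffP.
Qed.

(** The function is continued by the constant [g 0] to the left of 0, and [g1 0 = 0] is the matching
    condition there. Applied twice, it gives the C^2 functions below. *)
Lemma is_derive_max0 g g1 s : (forall t, 0 <= t -> is_derive t 1 g (g1 t)) ->
  g1 0 = 0 -> is_derive s 1 (fun t => g (Num.max t 0)) (g1 (Num.max s 0)).
Proof.
move=> dg g10; have [s0|s0|s0] := ltrgtP s 0.
- rewrite ?(max_r (ltW s0)) g10; apply: (near_eq_is_derive (f := cst (g 0))).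
  near=> t; rewrite max_r// ltW//; near: t; exact: lt_nbhsl.
- rewrite ?(max_l (ltW s0)); apply: (near_eq_is_derive (f := g)); last exact/dg/ltW.
  near=> t; rewrite max_l// ltW//; near: t; exact: lt_nbhsr.
rewrite s0 ?maxxx g10; apply: is_derive_bound => eps eps0.
have [dg0 dgv] := dg 0 (lexx 0).
have : (fun h : R => h^-1 *: ((g \o shift 0) (h *: (1 : R)) - g 0)) @ 0^' --> (0 : R).
  by rewrite -{4}g10 -dgv; exact: dg0.
move=> /cvgrPdist_le /(_ _ eps0); rewrite near_withinE => /nbhs_normP[d /= d0 hd].
exists d => // h hlt; rewrite mulr0 subr0 maxxx addr0 [h *: _]mulr1.
have [h0|h0] := leP h 0; first by rewrite subrr normr0 mulr_ge0// ltW.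
have := hd h; rewrite /= sub0r normrN => /(_ hlt) /(_ (lt0r_neq0 h0)).
rewrite sub0r normrN addr0 [h *: _]mulr1 normrM normfV.
by rewrite ler_pdivrMl ?normr_gt0 ?gt_eqF// [leRHS]mulrC.
Unshelve. all: by end_near. Qed.

Lemma continuous_max0 g : (forall t, 0 <= t -> {for t, continuous g}) ->
  continuous (fun t => g (Num.max t 0)).
Proof.
move=> cg t.
have cm : {for t, continuous (fun s : R => Num.max s 0)}.
  by apply: (@continuous_max _ _ id (cst 0)); [exact: cvg_id|exact: cst_continuous].
by apply: (continuous_comp cm); apply: cg; rewrite le_max lexx orbT.
Qed.

(** The lowest integral power of the positive part that is C^2. Bumps of this regularity suffice,
    since C^2_c functions are admissible in the weak formulation ([is_C2c_test]). *)
Definition cube_pos (t : R) := Num.max t 0 ^+ 3.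

Lemma is_derive_cube_pos t :
  is_derive t 1 cube_pos (3 * Num.max t 0 ^+ 2).
Proof.
apply: (@is_derive_max0 (fun s => s ^+ 3) (fun s => 3 * s ^+ 2)); last first.
  by rewrite expr0n mulr0.
move=> s _; apply: (is_derive_eq (is_deriveX 3 (is_derive_id s 1))).
by rewrite [LHS]mulr1.
Qed.

Lemma is_derive_cube_pos1 t :
  is_derive t 1 (fun t => 3 * Num.max t 0 ^+ 2) (6 * Num.max t 0).
Proof.
apply: (@is_derive_max0 (fun s => 3 * s ^+ 2) (fun s => 6 * s)); last first.
  by rewrite mulr0.
move=> s _; apply: (is_derive_eq (is_deriveZ 3 (is_deriveX 2 (is_derive_id s 1)))).
by rewrite -![_ *: _]/(_ * _); ring.
Qed.

Lemma continuous_cube_pos2 : continuous (fun t => 6 * Num.max t 0).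
Proof.
apply: (@continuous_max0 (fun t => 6 * t)) => t _.
by apply: (@continuousM _ _ (cst 6) id); [exact: cst_continuous|exact: cvg_id].
Qed.

(* A convex C^2 substitute for the positive part: it is [s ^ 3 / (1 + s) ^ 2]
   for [s >= 0] and [0] for [s <= 0]. *)
Definition smooth_pos0 s := s - 2 + 3 * (1 + s)^-1 - (1 + s)^-1 ^+ 2.
Definition smooth_pos0' s := 1 - 3 * (1 + s)^-1 ^+ 2 + 2 * (1 + s)^-1 ^+ 3.
Definition smooth_pos0'' s := 6 * (1 + s)^-1 ^+ 3 - 6 * (1 + s)^-1 ^+ 4.
Definition smooth_pos t := smooth_pos0 (Num.max t 0).
Definition smooth_pos' t := smooth_pos0' (Num.max t 0).
Definition smooth_pos'' t := smooth_pos0'' (Num.max t 0).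

Lemma is_derive_inv1D s : 0 <= s ->
  is_derive s 1 (fun t => (1 + t)^-1) (- (1 + s)^-1 ^+ 2).
Proof.
move=> s0; have s1 : 1 + s != 0 by rewrite gt_eqF// ltr_pwDl.
have h : is_derive s 1 (cst 1 + id) (0 + 1 : R) by exact: is_deriveD.
apply: (is_derive_eq (is_deriveV s1 h)).
by rewrite add0r [LHS]mulr1 exprVn.
Qed.

Lemma is_derive_smooth_pos0 s : 0 <= s ->
  is_derive s 1 smooth_pos0 (smooth_pos0' s).
Proof.
move=> s0; have di := is_derive_inv1D s0.
have h := is_deriveB (is_deriveD
  (is_deriveB (is_derive_id s (1 : R)) (is_derive_cst (2 : R) s (1 : R)))
  (is_deriveZ 3 di)) (is_deriveX 2 di).
apply: (is_derive_eq h); rewrite /smooth_pos0' -![_ *: _]/(_ * _) /=.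
by move: (1 + s)^-1 => i; ring.
Qed.

Lemma is_derive_smooth_pos0' s : 0 <= s ->
  is_derive s 1 smooth_pos0' (smooth_pos0'' s).
Proof.
move=> s0; have di := is_derive_inv1D s0.
have h := is_deriveD (is_deriveB (is_derive_cst (1 : R) s (1 : R))
  (is_deriveZ 3 (is_deriveX 2 di))) (is_deriveZ 2 (is_deriveX 3 di)).
apply: (is_derive_eq h); rewrite /smooth_pos0'' -![_ *: _]/(_ * _) /=.
by move: (1 + s)^-1 => i; ring.
Qed.

Lemma is_derive_smooth_pos t : is_derive t 1 smooth_pos (smooth_pos' t).
Proof.
apply: is_derive_max0 => [s|]; first exact: is_derive_smooth_pos0.
by rewrite /smooth_pos0' addr0 invr1; ring.
Qed.

Lemma is_derive_smooth_pos' t : is_derive t 1 smooth_pos' (smooth_pos'' t).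
Proof.
apply: is_derive_max0 => [s|]; first exact: is_derive_smooth_pos0'.
by rewrite /smooth_pos0'' addr0 invr1; ring.
Qed.

Lemma continuous_smooth_pos'' : continuous smooth_pos''.
Proof.
apply: continuous_max0 => s s0.
have ci : {for s, continuous (fun t => (1 + t)^-1)}.
  exact: (is_derive_derivable_continuous (g1 := fun=> _) (is_derive_inv1D s0)).
apply: (@continuousB _ _ _ (fun t => 6 * (1 + t)^-1 ^+ 3) (fun t => 6 * (1 + t)^-1 ^+ 4)).
  apply: (@continuousM _ _ (cst 6)); first exact: cst_continuous.
  exact: (continuous_comp ci (@exprn_continuous _ 3 _)).
apply: (@continuousM _ _ (cst 6)); first exact: cst_continuous.
exact: (continuous_comp ci (@exprn_continuous _ 4 _)).
Qed.

Lemma inv1D_itv t : 0 < (1 + Num.max t 0)^-1 <= 1.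
Proof.
have m0 : 0 <= Num.max t 0 by rewrite le_max lexx orbT.
by rewrite invr_gt0 ltr_pwDl//= invf_le1 ?ltr_pwDl// lerDl.
Qed.

Lemma smooth_pos'_itv t : 0 <= smooth_pos' t <= 1.
Proof.
have := inv1D_itv t; rewrite /smooth_pos' /smooth_pos0'.
move: (1 + Num.max t 0)^-1 => i /andP[i0 i1].
have h : 0 <= (1 - i) ^+ 2 * (1 + 2 * i).
  by rewrite mulr_ge0 ?sqr_ge0// addr_ge0// mulr_ge0// ltW.
have h2 : 0 <= i ^+ 2 * (3 - 2 * i) by rewrite mulr_ge0 ?sqr_ge0//; lra.
apply/andP; split.
  have -> // : 1 - 3 * i ^+ 2 + 2 * i ^+ 3 = (1 - i) ^+ 2 * (1 + 2 * i) by ring.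
rewrite -subr_ge0.
by have -> // : 1 - (1 - 3 * i ^+ 2 + 2 * i ^+ 3) = i ^+ 2 * (3 - 2 * i) by ring.
Qed.

(** The lower bound is the convexity behind Kato's inequality; the upper one makes [smooth_pos']
    6-Lipschitz, which is the origin of the 6 in that proof. *)
Lemma smooth_pos''_itv t : 0 <= smooth_pos'' t <= 6.
Proof.
have := inv1D_itv t; rewrite /smooth_pos'' /smooth_pos0''.
move: (1 + Num.max t 0)^-1 => i /andP[i0 i1].
have h : 0 <= i ^+ 3 * (1 - i) by rewrite mulr_ge0 ?exprn_ge0 ?subr_ge0 ?(ltW i0).
have h3 : i ^+ 3 <= 1 by rewrite exprn_ile1// ltW.
have h4 : 0 <= i ^+ 4 by rewrite exprn_ge0// ltW.
apply/andP; split.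
  have -> : 6 * i ^+ 3 - 6 * i ^+ 4 = 6 * (i ^+ 3 * (1 - i)) by ring.
  by rewrite mulr_ge0.
lra.
Qed.

Lemma smooth_pos_le0 t : t <= 0 -> smooth_pos t = 0.
Proof. by move=> t0; rewrite /smooth_pos max_r// /smooth_pos0 addr0 invr1; ring. Qed.

Lemma smooth_pos'_le0 t : t <= 0 -> smooth_pos' t = 0.
Proof. by move=> t0; rewrite /smooth_pos' max_r// /smooth_pos0' addr0 invr1; ring. Qed.

(** With [i = 1 / (1 + m)] in []0, 1]] the difference is [(1 - i) * (2 - i)], whose limit at
    infinity is 2. This is the 2 in the level [k + 2] later. *)
Lemma smooth_pos_bounds t : 0 <= Num.max t 0 - smooth_pos t <= 2.
Proof.
have := inv1D_itv t; rewrite /smooth_pos /smooth_pos0.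
move: (Num.max t 0) => m; move: (1 + m)^-1 => i /andP[i0 i1].
have h : 0 <= (1 - i) * (2 - i).
  by rewrite mulr_ge0 ?subr_ge0// (le_trans i1)// ler1n.
have -> : m - (m - 2 + 3 * i - i ^+ 2) = (1 - i) * (2 - i) by ring.
rewrite h/=; nra.
Qed.

Lemma smooth_pos_ge0 t : 0 <= smooth_pos t.
Proof.
have m0 : 0 <= Num.max t 0 by rewrite le_max lexx orbT.
rewrite /smooth_pos /smooth_pos0; move: m0; move: (Num.max t 0) => m m0.
have m1 : 1 + m != 0 by rewrite gt_eqF// ltr_pwDl.
have -> : m - 2 + 3 * (1 + m)^-1 - (1 + m)^-1 ^+ 2 = m ^+ 3 * (1 + m)^-1 ^+ 2 by field.
by rewrite mulr_ge0 ?exprn_ge0// invr_ge0 addr_ge0.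
Qed.

Lemma is_derive_lipschitz (phi phi1 : R -> R) (C a b : R) :
  (forall t : R, is_derive t 1 phi (phi1 t)) -> (forall t, `|phi1 t| <= C) ->
  `|phi a - phi b| <= C * `|a - b|.
Proof.
move=> dphi phiC.
have [t _] := @MVT_dir _ R^o phi phi1 b 1 (a - b) dphi.
rewrite [_ *: _]mulr1 subrK => ->.
by rewrite normrM ler_wpM2r.
Qed.

End real_functions.

(** * Bump functions and mollifiers *)

Section bumps.
Context {R : realType} {N : nat}.
Implicit Types (f : 'rV[R]_N -> R) (c x : 'rV[R]_N) (r : R).
Local Notation leb := (lebesgue_rV R N).

(** Built on the squared Euclidean distance, a polynomial, since the maximum norm is not smooth. The
    Euclidean ball lies in the ball of the maximum norm with the same radius, which gives
    [bump_neq0]. *)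
Definition bump c r x := cube_pos (r ^+ 2 - \sum_(i < N) (x ord0 i - c ord0 i) ^+ 2).

Lemma is_C2_bump c r : is_Ck 2 setT (bump c r).
Proof.
apply: (is_C2_comp (@is_derive_cube_pos R) (@is_derive_cube_pos1 R)
  (@continuous_cube_pos2 R)).
apply: is_CkB; first exact: is_Ck_cst.
apply: is_Ck_sum => i; under eq_fun do rewrite expr2.
by apply: is_CkM; (apply: is_CkB; [exact: is_Ck_coord|exact: is_Ck_cst]).
Qed.

Lemma bump_ge0 c r x : 0 <= bump c r x.
Proof. by rewrite exprn_ge0// le_max lexx orbT. Qed.

Lemma bump_center_gt0 c r : 0 < r -> 0 < bump c r c.
Proof.
move=> r0; rewrite /bump big1 ?subr0; last by move=> i _; rewrite subrr expr0n.
by rewrite exprn_gt0// lt_max exprn_gt0.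
Qed.

Lemma bump_neq0 c r x : 0 < r -> bump c r x != 0 -> `|x - c| < r.
Proof.
move=> r0; rewrite /bump; set S := \sum_(i < N) _ => h.
have S0 : 0 <= S by apply: sumr_ge0 => i _; exact: sqr_ge0.
have Sr : S < r ^+ 2.
  rewrite -subr_gt0 ltNge; apply: contra h => h.
  by rewrite /cube_pos max_r// expr0n.
apply: (@le_lt_trans _ _ (Num.sqrt S)).
  apply/le_rV_norm => [|i]; first exact: sqrtr_ge0.
  rewrite -sqrtr_sqr ler_sqrt// !mxE /S (bigD1 i)//= lerDl.
  by apply: sumr_ge0 => j _; exact: sqr_ge0.
by rewrite -(ger0_norm (ltW r0)) -sqrtr_sqr ltr_sqrt// exprn_gt0.
Qed.

Lemma bump_bounded_support c r : 0 < r -> bounded_support (bump c r).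
Proof.
move=> r0; exists (`|c| + r) => x cx; apply/eqP/negP => /negP /(bump_neq0 r0).
move=> h; move: cx; rewrite ltNge => /negP; apply.
by rewrite -[x](subrK c) addrC (le_trans (ler_normD _ _))// lerD2l ltW.
Qed.

Lemma lebesgue_rV_norm_le_gt0 r : 0 < r -> (0 < leb [set x | `|x| <= r]%R)%E.
Proof.
move=> r0; have -> : [set x : 'rV[R]_N | `|x| <= r] =
    [set x | forall i, (fun=> [set` `[- r, r]]) i (x ord0 i)].
  apply/seteqP; split=> x /=.
    by move=> /(le_rV_norm _ (ltW r0)) xM i; rewrite in_itv/= -ler_norml.
  move=> xM; apply/(le_rV_norm _ (ltW r0)) => i.
  by rewrite ler_norml; have := xM i; rewrite in_itv.
rewrite (@lebesgue_rV_prod R N (fun=> [set` `[- r, r]]))//.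
elim/big_rec : _ => [|i x _ x0]; first by rewrite lte01.
rewrite mule_gt0// lebesgue_measure_itv/= lte_fin gtrN// lte_fin.
by rewrite opprK addr_gt0.
Qed.

Lemma bump_integral_gt0 r : 0 < r -> 0 < \int[leb]_x bump 0 r x.
Proof.
move=> r0; have cb := is_Ck_continuous (is_C2_bump 0 r).
have b0 := bump_center_gt0 0 r0.
have FF : Filter (nbhs (0 : 'rV[R]_N)) by exact: nbhs_filter.
have : \forall x \near (0 : 'rV[R]_N), bump 0 r 0 / 2 < bump 0 r x.
  by apply: (@cvgr_gt _ _ _ FF _ _ (cb 0)); rewrite ltr_pdivrMr// ltr_pMr// ltr1n.
move=> /nbhs_normP[d /= d0 dB].
have d20 : 0 < d / 2 by rewrite divr_gt0.
pose A := [set x : 'rV[R]_N | `|x| <= d / 2].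
have Ai : leb.-integrable setT (EFin \o (fun x => \1_A x : R)).
  apply: intg_indic; last exact: lebesgue_rV_norm_le_fin.
  exact: (closed_measurable_rV (@closed_norm_le R N _)).
have A0 : 0 < \int[leb]_x (\1_A x : R).
  rewrite -lte_fin EFin_Rintegral// integral_indic ?setIT//.
    exact: lebesgue_rV_norm_le_gt0.
  exact: (closed_measurable_rV (@closed_norm_le R N _)).
apply: (@lt_le_trans _ _ (bump 0 r 0 / 2 * \int[leb]_x (\1_A x : R))).
  by rewrite mulr_gt0// divr_gt0.
rewrite -RintegralZl//; apply: le_Rintegral => //; first exact: intgZ.
  exact: (bounded_support_intg cb (bump_bounded_support 0 r0)).
move=> x _; rewrite indicE; have [xA|xA] := boolP (x \in A).
  rewrite mulr1 ltW//; apply: dB; rewrite /= sub0r normrN.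
  by move: xA; rewrite inE /A/= => /le_lt_trans; apply; rewrite ltr_pdivrMr// ltr_pMr// ltr1n.
by rewrite mulr0 bump_ge0.
Qed.

Lemma mollifier_exists (d : R) : 0 < d -> exists rho : 'rV[R]_N -> R,
  [/\ is_Ck 2 setT rho, bounded_support rho, (forall x, 0 <= rho x),
    (forall x, rho x != 0 -> `|x| < d) & \int[leb]_x rho x = 1].
Proof.
move=> d0; have I0 := bump_integral_gt0 d0.
set I := \int[leb]_x _ in I0.
have cb := is_Ck_continuous (is_C2_bump 0 d).
exists (fun x => I^-1 * bump 0 d x); split.
- by apply: is_CkM; [exact: is_Ck_cst|exact: is_C2_bump].
- by apply: bounded_supportMr; exact: bump_bounded_support.
- by move=> x; rewrite mulr_ge0 ?bump_ge0// invr_ge0 ltW.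
- move=> x; rewrite mulf_eq0 negb_or => /andP[_ /(bump_neq0 d0)].
  by rewrite subr0.
- rewrite RintegralZl ?mulVf ?gt_eqF//.
  exact: (bounded_support_intg cb (bump_bounded_support 0 d0)).
Qed.

End bumps.

(** * Green's formula and Kato's inequality *)

Section Green.
Context {R : realType} {N : nat}.
Implicit Types f psi : 'rV[R]_N -> R.
Local Notation leb := (lebesgue_rV R N).
Local Notation intg f := (leb.-integrable [set: 'rV[R]_N] (EFin \o f)).

Lemma continuousM_rV f g : continuous f -> continuous g ->
  continuous (fun x : 'rV[R]_N => f x * g x).
Proof. by move=> cf cg x; apply: continuousM; [exact: cf|exact: cg]. Qed.

Lemma intg_laplacianM f psi : continuous f -> is_Ck 2 setT psi ->
  bounded_support psi -> intg (fun x => f x * laplacian psi x).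
Proof.
move=> cf psi2 bpsi; apply: bounded_support_intg.
  by apply: continuousM_rV => //; exact: is_C0_laplacian.
by apply: bounded_supportMr; exact: bounded_support_laplacian.
Qed.

(** The difference of the integrands is the divergence of the field [F = f grad psi - psi grad f],
    each component of which has bounded support because of [psi] and so a derivative of integral
    0. *)
Lemma Green f psi : is_Ck 2 setT f -> is_Ck 2 setT psi -> bounded_support psi ->
  \int[leb]_x (f x * laplacian psi x) = \int[leb]_x (psi x * laplacian f x).
Proof.
move=> f2 psi2 bpsi.
have f1 := is_CkS f2; have psi1 := is_CkS psi2.
have fp i : is_Ck 1 setT (partial i f) by exact: is_Ck_partial.
have pp i : is_Ck 1 setT (partial i psi) by exact: is_Ck_partial.
have bp i : bounded_support (partial i psi) by exact: bounded_support_partial.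
pose F i x := f x * partial i psi x - psi x * partial i f x.
have F1 i : is_Ck 1 setT (F i) := is_CkB (is_CkM f1 (pp i)) (is_CkM psi1 (fp i)).
have bF i : bounded_support (F i).
  apply: bounded_supportD; first exact: bounded_supportMr.
  under eq_fun do rewrite -mulrN; exact: bounded_supportM.
have FE i x : partial i (F i) x =
    f x * partial i (partial i psi) x - psi x * partial i (partial i f) x.
  rewrite (partialB i (is_CkM f1 (pp i)) (is_CkM psi1 (fp i))).
  rewrite (partialM i f1 (pp i)) (partialM i psi1 (fp i)).
  move: (partial i (partial i psi) x) (partial i (partial i f) x) => a b.
  by move: (partial i psi x) (partial i f x) (f x) (psi x) => c d r s; ring.
have i1 := intg_laplacianM (is_Ck_continuous f2) psi2 bpsi.
have i2 : intg (fun x => psi x * laplacian f x).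
  apply: bounded_support_intg; last exact: bounded_supportM.
  by apply: continuousM_rV; [exact: is_Ck_continuous psi2|exact: is_C0_laplacian].
apply: subr0_eq; rewrite -(RintegralB measurableT i1 i2).
transitivity (\int[leb]_x (\sum_(i < N) partial i (F i) x)).
  apply: eq_Rintegral => x _; rewrite /laplacian !mulr_sumr -sumrB.
  by apply: eq_bigr => i _; rewrite FE.
rewrite Rintegral_sum; first by rewrite big1// => i _; exact: Rintegral_partial.
move=> i; apply: bounded_support_intg; last exact: bounded_support_partial.
exact: (is_Ck_continuous (is_Ck_partial i (F1 i))).
Qed.

End Green.

Section Kato.
Context {R : realType} {N : nat}.
Implicit Types (w g psi zeta : 'rV[R]_N -> R) (Omega : set 'rV[R]_N).
Local Notation leb := (lebesgue_rV R N).
Local Notation intg f := (leb.-integrable [set: 'rV[R]_N] (EFin \o f)).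

Lemma is_Ckc_notin k Omega f x : is_Ckc k Omega f -> ~ Omega x -> f x = 0.
Proof.
move=> [_ _ fO] Ox; apply: contrapT => /eqP fx; apply/Ox/fO.
by apply: subset_closure.
Qed.

Lemma is_Ckc_local k Omega f (c : 'rV[R]_N) (r : R) : is_Ck k setT f ->
  (forall x, f x != 0 -> `|x - c| < r) ->
  (forall x, `|x - c| <= r -> Omega x) -> is_Ckc k Omega f.
Proof.
move=> fk fr rO; pose A := [set x : 'rV[R]_N | `|x - c| <= r].
have cA : closed A.
  apply: (@closed_comp _ _ (fun x : 'rV[R]_N => `|x - c|) [set t : R | t <= r]).
    move=> x _; apply: (@continuous_comp _ _ _ (fun z : 'rV[R]_N => z - c) (fun z => `|z|)).
      by apply: (@continuousB _ _ _ id (cst c)); [exact: cvg_id|exact: cst_continuous].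
    exact: norm_continuous.
  exact: closed_le.
have fA : fsupport f `<=` A.
  rewrite [X in _ `<=` X]((closure_id A).1 cA).
  by apply: closure_subset => x /fr; exact: ltW.
have bA : bounded_set A.
  exists (`|c| + r); split=> [|t ct x /= xr]; first exact: num_real.
  rewrite -[x](subrK c) addrC (le_trans (ler_normD _ _))// ltW// (le_lt_trans _ ct)//.
  by rewrite lerD2l.
split => //; last by move=> x /fA; exact: rO.
apply: subclosed_compact fA; first exact: closed_closure.
exact: bounded_closed_compact.
Qed.

(** The hypothesis [sub] says that [Delta w >= g] weakly. For the mollified [W] and [G] it becomes
    pointwise on the support of [psi], and convexity gives [Delta (Phi o W) >= Phi' (W) * G] there.
    The product [Phi' (w) * g] is nonnegative, because [Phi' (w)] vanishes for [w <= k]; what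
    remains is to control the error of replacing [w], [g] by [W], [G]. *)
Lemma Kato Omega w g psi (k M0 : R) : open Omega -> intg w -> intg g ->
  (forall x, M0 < `|x| -> w x = 0) -> (forall x, M0 < `|x| -> g x = 0) ->
  (forall x, k < w x -> 0 <= g x) ->
  (forall zeta, is_Ckc 2 Omega zeta -> (forall x, 0 <= zeta x) ->
    \int[leb]_x (g x * zeta x) <= \int[leb]_x (w x * laplacian zeta x)) ->
  is_Ckc 2 Omega psi -> (forall x, 0 <= psi x) -> 0 <= k ->
  0 <= \int[leb]_x (smooth_pos (w x - k) * laplacian psi x).
Proof.
move=> oO wi gi wM gM gk sub psic psi0 k0.
have bpsi := is_Ckc_bounded_support psic.
have [psi2 psicp psiO] := psic.
have cpsi := is_Ck_continuous psi2.
have cL := is_C0_laplacian psi2.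
have bL := bounded_support_laplacian bpsi.
have [C1 C10 LC] := bounded_support_bounded cL bL.
have [C2 C20 pC] := bounded_support_bounded cpsi bpsi.
pose Phi (t : R) : R := smooth_pos (t - k); pose Phi' (t : R) : R := smooth_pos' (t - k).
pose Phi'' (t : R) : R := smooth_pos'' (t - k).
have dPhi (t : R) : is_derive t 1 Phi (Phi' t).
  by apply: (@is_derive_translate R R^o smooth_pos); exact: is_derive_smooth_pos.
have dPhi' (t : R) : is_derive t 1 Phi' (Phi'' t).
  by apply: (@is_derive_translate R R^o smooth_pos'); exact: is_derive_smooth_pos'.
have cPhi'' : continuous Phi''.
  move=> t; apply: (@continuous_comp _ _ _ (fun s : R => s - k) smooth_pos'').
    by apply: (@continuousB _ _ _ id (cst k)); [exact: cvg_id|exact: cst_continuous].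
  exact: continuous_smooth_pos''.
have Phi_lip (a b : R) : `|Phi a - Phi b| <= `|a - b|.
  rewrite -[leRHS]mul1r; apply: is_derive_lipschitz => // t.
  by have /andP[h0 h1] := smooth_pos'_itv (t - k); rewrite ger0_norm.
have Phi'_lip (a b : R) : `|Phi' a - Phi' b| <= 6 * `|a - b|.
  apply: is_derive_lipschitz => // t.
  by have /andP[h0 h1] := smooth_pos''_itv (t - k); rewrite ger0_norm.
have cPhi : continuous Phi.
  by move=> t; exact: (is_derive_derivable_continuous (dPhi t)).
have mPhi : measurable_fun setT Phi by exact: continuous_measurable_fun.
have PhiLi f : intg f -> intg (fun x => Phi (f x) * laplacian psi x).
  move=> fi; under eq_fun do rewrite mulrC.
  apply: (@intg_le _ _ _ leb _ (fun x => C1 * `|f x|)).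
  - apply: measurable_funM; first exact: continuous_measurable_rV.
    by apply: measurableT_comp => //; exact: intg_measurable fi.
  - by apply: intgZ; exact: intg_norm.
  - move=> x; rewrite normrM ler_pM//.
    by have := Phi_lip (f x) 0; rewrite /Phi sub0r (@smooth_pos_le0 _ (- k)) ?oppr_le0// !subr0.
suff h tau : 0 < tau -> - ((C1 + 3 * C2) * tau) <= \int[leb]_x (Phi (w x) * laplacian psi x).
  apply/ler_addgt0Pl => eps eps0.
  have C0 : 0 < C1 + 3 * C2 + 1 by rewrite ltr_wpDl// addr_ge0// mulr_ge0.
  rewrite -lerBlDl sub0r; apply: le_trans (h _ (divr_gt0 eps0 C0)).
  rewrite lerN2 mulrC -mulrA ler_piMr ?(ltW eps0)// ler_pdivrMl// mulr1 lerDl//.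
move=> tau0.
have [M M1 tailM] := intg_tail gi tau0.
(* Chosen so that both [tau' <= tau] and [6 * M * tau' <= tau]. The three terms of [E] below then
   cost at most [tau] each, whence [3 * C2]; moving from [Phi (W)] to [Phi (w)] costs
   [C1 * tau']. *)
pose tau' := tau / (6 * M + 1).
have M61 : 0 < 6 * M + 1 by rewrite ltr_wpDl// mulr_ge0.
have tau'0 : 0 < tau' by rewrite divr_gt0.
have tau'1 : tau' <= tau.
  by rewrite ler_pdivrMr// ler_peMr ?(ltW tau0)// lerDr mulr_ge0.
have tau'2 : 6 * M * tau' <= tau.
  rewrite /tau' mulrCA ler_piMr ?(ltW tau0)// ler_pdivrMr// mul1r lerDl//.
have [d1 d10 h1] := intg_L1_continuous wi wM tau'0.
have [d2 d20 h2] := intg_L1_continuous gi gM tau'0.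
have [d3 d30 h3] := compact_thickening psicp oO psiO.
(* The first two radii make the mollification errors of [w] and [g] small in L^1; the third keeps
   mollifiers centred on the support of [psi] inside [Omega]. *)
pose d := Num.min (Num.min d1 d2) (d3 / 2).
have d0 : 0 < d by rewrite !lt_min d10 d20 divr_gt0.
have dd1 : d <= d1 by rewrite !ge_min lexx.
have dd2 : d <= d2 by rewrite !ge_min lexx orbT.
have dd3 : d < d3.
  by rewrite gt_min; apply/orP; right; rewrite ltr_pdivrMr// ltr_pMr// ltr1n.
have [rho [rho2 brho rho0 rhod rho1]] := @mollifier_exists R N d d0.
have crho := is_Ck_continuous rho2.
have [Wi Wtau] := conv_L1 wi crho brho rho0 rhod rho1
  (fun z zd => h1 z (lt_le_trans zd dd1)).
have [Gi Gtau] := conv_L1 gi crho brho rho0 rhod rho1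
  (fun z zd => h2 z (lt_le_trans zd dd2)).
set W := conv w rho in Wi Wtau; set G := conv g rho in Gi Gtau.
have W2 : is_Ck 2 setT W by exact: is_C2_conv.
(* Differentiating under the integral puts the Laplacian on the translate of [rho] centred at [x],
   which is itself an admissible test function for [sub]. *)
have GW x : fsupport psi x -> G x <= laplacian W x.
  move=> sx; rewrite laplacian_conv// /conv.
  under [leRHS]eq_Rintegral do rewrite -(laplacian_translate _ _ rho2).
  apply: sub => [|y]; last exact: rho0.
  apply: (@is_Ckc_local _ _ _ x d); first exact: is_Ck_translate.
    by move=> y /rhod.
  by move=> y xy; apply: (h3 x) => //; rewrite distrC (le_lt_trans xy).
have PW2 : is_Ck 2 setT (Phi \o W) := is_C2_comp dPhi dPhi' cPhi'' W2.
have WB : intg (fun x => `|W x - w x|) by apply: intg_norm; exact: intgB.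
have GB : intg (fun x => `|G x - g x|) by apply: intg_norm; exact: intgB.
have mg := intg_measurable gi.
have Ti : intg (fun x => Num.max (`|g x| - M) 0).
  apply: (@intg_le _ _ _ leb _ (fun x => `|g x|)).
  - apply: measurable_maxr => //; apply: measurable_funB => //.
    exact: measurableT_comp.
  - exact: intg_norm.
  - move=> x; rewrite ger0_norm ?le_max ?lexx ?orbT// ge_max normr_ge0 andbT.
    by rewrite lerBlDr lerDl.
pose E x := `|G x - g x| + 6 * M * `|W x - w x| + Num.max (`|g x| - M) 0.
have Ei : intg E.
  by apply: intgD => //; apply: intgD => //; exact: intgZ.
have step2 x : - (C2 * E x) <= psi x * laplacian (Phi \o W) x.
  have E0 : 0 <= E x.
    by rewrite !addr_ge0// ?mulr_ge0// le_max lexx orbT.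
  have [sx|sx] := pselect (fsupport psi x); last first.
    have -> : psi x = 0.
      by apply: contrapT => /eqP px; apply: sx; exact: subset_closure.
    by rewrite mul0r oppr_le0 mulr_ge0.
  rewrite (laplacian_comp x dPhi dPhi' cPhi'' W2).
  have /andP[P0 P1] := smooth_pos'_itv (W x - k).
  rewrite -/(Phi' (W x)) in P0 P1.
  have PP0 : 0 <= Phi'' (W x) * \sum_(i < N) partial i W x ^+ 2.
    rewrite mulr_ge0 ?sumr_ge0//; first by have /andP[] := smooth_pos''_itv (W x - k).
    by move=> i _; exact: sqr_ge0.
  apply: (@le_trans _ _ (psi x * - E x)).
    by rewrite mulrN lerN2 ler_wpM2r// (le_trans (ler_norm _)).
  rewrite ler_wpM2l// -[X in X <= _]addr0 lerD//.
  apply: (@le_trans _ _ (Phi' (W x) * G x)); last by rewrite ler_wpM2l// GW.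
  have a1 : - `|G x - g x| <= Phi' (W x) * (G x - g x).
    rewrite lerNl (le_trans (ler_norm _))// normrN normrM ger0_norm//.
    by rewrite ler_piMl.
  (* Only [g x < 0] is at issue. There [w x <= k], so [Phi' (w x) = 0] and
     [Phi' (W x) <= 6 * |W x - w x|]. As [g] is unbounded, this Lipschitz bound is used on the part
     of [|g|] up to [M], and [Phi' <= 1] on the excess. *)
  have a2 : - (6 * M * `|W x - w x| + Num.max (`|g x| - M) 0) <= Phi' (W x) * g x.
    have T0 : 0 <= Num.max (`|g x| - M) 0 by rewrite le_max lexx orbT.
    have [g0|g0] := leP 0 (g x).
      rewrite (@le_trans _ _ 0)//; first by rewrite oppr_le0 addr_ge0// !mulr_ge0.
      by rewrite mulr_ge0.
    have wk : w x <= k by rewrite leNgt; apply/negP => /gk; rewrite leNgt g0.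
    have Pl := Phi'_lip (W x) (w x).
    rewrite [X in _ - X]/Phi' (@smooth_pos'_le0 _ (w x - k)) ?subr_le0// subr0 ger0_norm// in Pl.
    rewrite -[g x]opprK mulrN lerN2 -(ltr0_norm g0) normrN normr_id.
    have -> : Phi' (W x) * `|g x| = Phi' (W x) * M + Phi' (W x) * (`|g x| - M).
      by rewrite -mulrDr addrC subrK.
    apply: lerD; first by rewrite mulrAC ler_wpM2r.
    case: (lerP 0 (`|g x| - M)) => gM'.
      by apply: (@le_trans _ _ (`|g x| - M)); [rewrite ler_piMl|rewrite ?le_max ?lexx].
    by apply: (@le_trans _ _ 0); [rewrite mulr_ge0_le0// ltW|rewrite ?le_max ?lexx ?orbT].
  have -> : Phi' (W x) * G x = Phi' (W x) * (G x - g x) + Phi' (W x) * g x.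
    by rewrite -mulrDr subrK.
  by rewrite /E -addrA opprD lerD.
have key1 : \int[leb]_x (Phi (W x) * laplacian psi x) - C1 * tau' <=
    \int[leb]_x (Phi (w x) * laplacian psi x).
  rewrite lerBlDr -lerBlDl -RintegralB//; [|exact: PhiLi..].
  apply: (@le_trans _ _ (\int[leb]_x (C1 * `|W x - w x|))).
    apply: le_Rintegral => //.
    - by apply: intgB; exact: PhiLi.
    - exact: intgZ.
    - move=> x _; rewrite -mulrBl (le_trans (ler_norm _))// normrM mulrC.
      by rewrite ler_pM.
  by rewrite RintegralZl// ler_wpM2l.
have key2 : - (C2 * (tau' + 6 * M * tau' + tau)) <= \int[leb]_x (Phi (W x) * laplacian psi x).
  rewrite (Green PW2 psi2 bpsi).
  apply: (@le_trans _ _ (\int[leb]_x (- C2 * E x))).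
    rewrite RintegralZl// mulNr lerN2 ler_wpM2l//.
    rewrite RintegralD//; last by apply: intgD => //; exact: intgZ.
    rewrite RintegralD//; last exact: intgZ.
    rewrite RintegralZl// !lerD// ler_wpM2l// mulr_ge0//.
  apply: le_Rintegral => //.
  - exact: intgZ.
  - exact: (bounded_support_intg (continuousM_rV cpsi (is_C0_laplacian PW2))
      (bounded_supportM _ bpsi)).
  - by move=> x _; rewrite mulNr; exact: step2.
apply: le_trans key1; rewrite lerBrDr; apply: le_trans key2.
have b1 : C1 * tau' <= C1 * tau by rewrite ler_wpM2l.
have b2 : C2 * (tau' + 6 * M * tau' + tau) <= C2 * (3 * tau).
  rewrite ler_wpM2l//; lra.
move: b1 b2; move: (C2 * (_ + _)) (C1 * tau') => A B b1 b2; lra.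
Qed.

End Kato.

(** * Test functions *)

Section test_functions.
Context {R : realType} {N : nat}.
Implicit Types (f g psi zeta : 'rV[R]_N -> R) (Omega K : set 'rV[R]_N) (x : 'rV[R]_N).
Local Notation leb := (lebesgue_rV R N).
Local Notation intg f := (leb.-integrable [set: 'rV[R]_N] (EFin \o f)).

Lemma is_Ckc_near_notin k Omega f x : is_Ckc k Omega f -> ~ Omega x ->
  \near x, f x = 0.
Proof.
move=> [_ _ fO] Ox; have : nbhs x (~` fsupport f).
  apply: open_nbhs_nbhs; split; last by move=> /fO.
  exact/closed_openC/closed_closure.
apply: filterS => y fy; apply: contrapT => /eqP y0; apply: fy.
exact: subset_closure.
Qed.

Lemma partial_near0_near f i (x : 'rV[R]_N) : (\near x, f x = 0) -> \near x, partial i f x = 0.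
Proof.
by move=> /nbhs_interior; apply: filterS => y; exact: partial_near0.
Qed.

Lemma is_Ckc_partial_notin k Omega f i x : is_Ckc k Omega f -> ~ Omega x ->
  partial i f x = 0.
Proof. by move=> fc Ox; apply: partial_near0; exact: is_Ckc_near_notin fc Ox. Qed.

Lemma is_Ckc_laplacian_notin k Omega f x : is_Ckc k Omega f -> ~ Omega x ->
  laplacian f x = 0.
Proof.
move=> fc Ox; rewrite /laplacian big1// => i _; apply: partial_near0.
by apply: partial_near0_near; exact: is_Ckc_near_notin fc Ox.
Qed.

Lemma is_Ckc_sub k Omega f g : is_Ck k setT f -> (forall x, g x = 0 -> f x = 0) ->
  is_Ckc k Omega g -> is_Ckc k Omega f.
Proof.
move=> fk gf [_ cg gO].
have fg : fsupport f `<=` fsupport g.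
  by apply: closure_subset => x /=; apply: contra => /eqP /gf /eqP.
split=> //; last exact: subset_trans gO.
by apply: subclosed_compact cg fg; exact: closed_closure.
Qed.

(** The measure is arbitrary because both the Lebesgue measure and [mu] are meant. *)
Lemma integral_support (m : {measure set 'rV[R]_N -> \bar R}) Omega (F : 'rV[R]_N -> \bar R) :
  (forall x, ~ Omega x -> F x = 0%E) ->
  (\int[m]_(x in Omega) F x = \int[m]_x F x)%E.
Proof.
move=> F0; rewrite integral_mkcond; apply: eq_integral => x _.
by rewrite patchE; case: ifPn => //; rewrite notin_setE => /F0.
Qed.

Lemma compact_measurable_rV K : compact K -> measurable K.
Proof.
move=> cK; apply: closed_measurable_rV; apply: compact_closed cK.
exact: norm_hausdorff.
Qed.

Lemma bounded_support_Linfty Omega f : open Omega -> continuous f -> bounded_support f ->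
  Linfty Omega f.
Proof.
move=> oO cf bf; have [C C0 fC] := bounded_support_bounded cf bf.
have mO := open_measurable_rV oO.
rewrite /Linfty; apply/andP; split; rewrite inE/=.
  apply/(measurable_restrictT _ mO).
  exact: measurable_funTS (continuous_measurable_rV cf).
rewrite /finite_norm unlock; case: ifPn => _; last exact: ltry.
apply: (@le_lt_trans _ _ C%:E); last exact: ltry.
apply: ereal_inf_lbound; apply: aeW => x /=; rewrite lee_fin patchE.
by case: ifP => // _; rewrite normr0.
Qed.

Lemma bounded_support_L1loc Omega f : open Omega -> continuous f -> bounded_support f ->
  L1loc Omega f.
Proof.
move=> oO cf bf; split; first exact: measurable_funTS (continuous_measurable_rV cf).
move=> K cK _; apply: (integrableS measurableT) (bounded_support_intg cf bf) => //.
exact: compact_measurable_rV.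
Qed.

(** Integration by parts: [f * phi] has bounded support, so its partial derivative integrates to
    0. *)
Lemma weak_partial_C1 Omega f i : open Omega -> is_Ck 1 setT f -> bounded_support f ->
  weak_partial Omega i f (partial i f).
Proof.
move=> oO f1 bf.
have cf := is_Ck_continuous f1; have cg := is_Ck_continuous (is_Ck_partial i f1).
have bg := bounded_support_partial i bf.
split; [exact: bounded_support_L1loc..|] => phi tphi.
have phic := tphi 1%N; have bphi := is_Ckc_bounded_support phic.
have [phi1 _ _] := phic; have cphi := is_Ck_continuous phi1.
have cpphi := is_Ck_continuous (is_Ck_partial i phi1).
have e1 : (\int[leb]_(x in Omega) (f x * partial i phi x)%:E =
    \int[leb]_x (f x * partial i phi x)%:E)%E.
  apply: (@integral_support leb Omega (fun x => (f x * partial i phi x)%:E)) => x Ox.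
  by rewrite (is_Ckc_partial_notin i phic Ox) mulr0.
have e2 : (\int[leb]_(x in Omega) (partial i f x * phi x)%:E =
    \int[leb]_x (partial i f x * phi x)%:E)%E.
  apply: (@integral_support leb Omega (fun x => (partial i f x * phi x)%:E)) => x Ox.
  by rewrite (is_Ckc_notin phic Ox) mulr0.
rewrite e1 e2.
have i1 := bounded_support_intg (continuousM_rV cf cpphi) (bounded_supportM (partial i phi) bf).
have i2 := bounded_support_intg (continuousM_rV cg cphi) (bounded_supportM phi bg).
rewrite -(EFin_Rintegral i1) -(EFin_Rintegral i2) -EFinN; congr EFin; apply/eqP.
rewrite -addr_eq0 -(RintegralD measurableT i1 i2); apply/eqP.
have := @Rintegral_partial _ _ (fun x => f x * phi x) i (is_CkM f1 phi1)
  (bounded_supportM _ bf).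
rewrite partialM// => h; rewrite -[RHS]h; apply: eq_Rintegral => x _.
by rewrite [phi x * _]mulrC.
Qed.

(** The bridge from the Sobolev test space to classical functions: the weak derivatives are the
    classical ones, bounded because they are continuous of bounded support. *)
Lemma is_C2c_test Omega zeta : open Omega -> is_Ckc 2 Omega zeta ->
  [/\ W1infty0 Omega zeta, Wkinfty 2 Omega zeta &
      weak_laplacian Omega zeta (laplacian zeta)].
Proof.
move=> oO zc; have bz := is_Ckc_bounded_support zc; have [z2 _ _] := zc.
have cz := is_Ck_continuous z2; have z1 := is_CkS z2.
have p1 i : is_Ck 1 setT (partial i zeta) by exact: is_Ck_partial.
have cp i := is_Ck_continuous (p1 i).
have bp i := bounded_support_partial i bz.
have cpp i j := is_Ck_continuous (is_Ck_partial j (p1 i)).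
have bpp i j := bounded_support_partial j (bp i).
split.
- split; last by move=> x [_]; rewrite ((interior_id _).1 oO) => /(is_Ckc_notin zc).
    split; first exact: bounded_support_Linfty.
    move=> i; exists (partial i zeta); first exact: weak_partial_C1.
    by split => //; exact: bounded_support_Linfty.
  exact: continuous_subspaceT.
- split; first exact: bounded_support_Linfty.
  move=> i; exists (partial i zeta); first exact: weak_partial_C1.
  split; first exact: bounded_support_Linfty.
  move=> j; exists (partial j (partial i zeta)); first exact: weak_partial_C1.
  by split => //; exact: bounded_support_Linfty.
- exists (fun i => partial i zeta), (fun i => partial i (partial i zeta)).
  by split => // i; split; exact: weak_partial_C1.
Qed.

Lemma cutoff_exists Omega K : open Omega -> compact K -> K `<=` Omega ->
  exists chi, [/\ is_Ckc 2 Omega chi, (forall x, 0 <= chi x) &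
    forall x, K x -> chi x = 1].
Proof.
move=> oO cK KO; have [d d0 Kd] := compact_thickening cK oO KO.
have [B [_ KB]] := compact_bounded cK.
(* The function [chi] mollifies, at scale [r], the indicator of the [r]-neighbourhood [A] of [K]. So
   it equals 1 on [K], lives in the [2 * r]-neighbourhood, and taking the closure costs a third [r],
   which stays within [d]. *)
pose r := d / 3; have r0 : 0 < r by rewrite divr_gt0.
pose A := \bigcup_(x in K) ball x r.
have mA : measurable A.
  by apply: open_measurable_rV; apply: bigcup_open => x _; exact: ball_open.
have AE x : A x <-> exists2 y, K y & `|y - x| < r.
  by split=> [[y Ky]|[y Ky yx]]; [|exists y => //]; rewrite -ball_normE; [exists y|].
have AB x : A x -> `|x| <= B + 1 + r.
  move=> /AE[y Ky yx]; have yB : `|y| <= B + 1 by apply: (KB (B + 1)) => //; rewrite ltrDl.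
  by rewrite -[x](subrK y) addrC (le_trans (ler_normD _ _))// lerD// distrC ltW.
have Ai : intg (fun x => \1_A x).
  apply: intg_indic => //; apply: le_lt_trans (@lebesgue_rV_norm_le_fin R N (B + 1 + r)).
  apply: le_measure; rewrite ?inE//.
  exact: (closed_measurable_rV (@closed_norm_le R N _)).
have [rho [rho2 brho rho0 rhod rho1]] := @mollifier_exists R N r r0.
have crho := is_Ck_continuous rho2.
pose chi := conv (fun x => \1_A x) rho.
have chi2 : is_Ck 2 setT chi by exact: is_C2_conv.
have chiE x : chi x = \int[leb]_z (\1_A (z + x) * rho z) by exact: conv_translate.
have chi_neq0 x : chi x != 0 -> exists2 y, K y & `|y - x| < 2 * r.
  move=> chix; apply: contrapT => h; move/eqP : chix; apply.
  rewrite chiE (@eq_Rintegral _ _ _ leb setT (cst 0)); first by rewrite /Rintegral integral0.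
  move=> z _ /=; have [->|/rhod zr] := eqVneq (rho z) 0; first by rewrite mulr0.
  rewrite indicE memNset ?mul0r// => /AE[y Ky yx]; apply: h; exists y => //.
  rewrite -(subrKA (z + x)) (le_lt_trans (ler_normD _ _))//.
  by rewrite mulr2n mulrDl !mul1r ltrD// addrK.
exists chi; split.
- have sub : fsupport chi `<=` [set x | exists2 y, K y & `|y - x| < d].
    move=> x; rewrite /fsupport closureEnbhs => h.
    have [z [/= /chi_neq0[y Ky yz] xz]] : [set x | chi x != 0] `&` ball x r !=set0.
      by apply: (h _ (ball x r)) => //; exact: nbhsx_ballx.
    exists y => //; rewrite -(subrKA z) (le_lt_trans (ler_normD _ _))//.
    rewrite (_ : d = 2 * r + r); last by rewrite /r; field.
    by rewrite ltrD// distrC; move: xz; rewrite -ball_normE.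
  split => //; last by move=> x /sub[y Ky /(Kd _ _ Ky)].
  apply: bounded_closed_compact; last exact: closed_closure.
  exists (B + 1 + d); split=> [|t ct x /= /sub[y Ky yx]]; first exact: num_real.
  have yB : `|y| <= B + 1 by apply: (KB (B + 1)) => //; rewrite ltrDl.
  rewrite -[x](subrK y) addrC (le_trans (ler_normD _ _))// ltW// (le_lt_trans _ ct)//.
  by rewrite lerD// distrC ltW.
- by move=> x; rewrite chiE; apply: Rintegral_ge0 => z _; rewrite mulr_ge0// indicE.
- move=> x Kx; rewrite chiE -rho1; apply: eq_Rintegral => z _.
  have [->|/rhod zr] := eqVneq (rho z) 0; first by rewrite mulr0.
  rewrite indicE mem_set ?mul1r//; apply/AE; exists x => //.
  by rewrite opprD addrCA subrr addr0 normrN.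
Qed.

End test_functions.

Section weak_solution_identity.
Context {R : realType} {N : nat}.
Implicit Types (u zeta : 'rV[R]_N -> R) (Omega : set 'rV[R]_N).
Local Notation leb := (lebesgue_rV R N).
Local Notation intg f := (leb.-integrable [set: 'rV[R]_N] (EFin \o f)).

Lemma intg_restrict Omega f : open Omega -> L1 Omega f -> intg (f \_ Omega).
Proof.
move=> oO; move/(integrable_mkcond _ (open_measurable_rV oO)).
by rewrite restrict_EFin.
Qed.

Lemma intg_restrict_cst Omega (c : R) : open Omega -> bounded_set Omega ->
  intg (cst c \_ Omega).
Proof.
move=> oO [B [_ OB]]; rewrite (_ : _ \_ _ = (fun x => c * \1_Omega x)); last first.
  by apply/funext => x; rewrite patchE indicE; case: ifP => _; rewrite ?mulr1 ?mulr0.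
apply: intgZ; apply: intg_indic; first exact: open_measurable_rV.
apply: (le_lt_trans _ (@lebesgue_rV_norm_le_fin R N (B + 1))).
apply: le_measure; rewrite ?inE.
- exact: open_measurable_rV.
- exact: (closed_measurable_rV (@closed_norm_le R N _)).
- by move=> x Ox; apply: (OB (B + 1)) => //; rewrite ltrDl.
Qed.

Lemma weak_solution_identity Omega (mu : {finite_measure set 'rV[R]_N -> \bar R})
    u zeta : open Omega -> bounded_set Omega -> weak_solution Omega mu u ->
  is_Ckc 2 Omega zeta ->
  \int[leb]_x (((fun x => - u x) \_ Omega) x * laplacian zeta x) -
  \int[leb]_x (((fun x => 1 - expR (u x)) \_ Omega) x * zeta x) =
  \int[mu]_x zeta x.
Proof.
move=> oO bO [u1 eu1 sol] zc; have [t1 t2 t3] := is_C2c_test oO zc.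
have bz := is_Ckc_bounded_support zc; have [z2 _ _] := zc.
have cz := is_Ck_continuous z2; have cL := is_C0_laplacian z2.
have [C1 C10 LC] := bounded_support_bounded cL (bounded_support_laplacian bz).
have [C2 C20 zC] := bounded_support_bounded cz bz.
have wi : intg ((fun x => - u x) \_ Omega).
  have := intgN (intg_restrict oO u1); apply: eq_integrable => // x _ /=.
  by rewrite !patchE; case: ifP => // _; rewrite oppr0.
have gi : intg ((fun x => 1 - expR (u x)) \_ Omega).
  have := intgB (intg_restrict_cst 1 oO bO) (intg_restrict oO eu1).
  apply: eq_integrable => // x _ /=.
  by rewrite !patchE; case: ifP => // _; rewrite subr0.
have i1 : intg (fun x => ((fun x => - u x) \_ Omega) x * laplacian zeta x).
  by apply: (@intgM_bounded _ _ _ leb _ _ C1) => //; exact: continuous_measurable_rV.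
have i2 : intg (fun x => ((fun x => 1 - expR (u x)) \_ Omega) x * zeta x).
  by apply: (@intgM_bounded _ _ _ leb _ _ C2) => //; exact: continuous_measurable_rV.
rewrite -RintegralB//; congr fine.
have := sol _ _ t1 t2 t3.
rewrite (@integral_support _ _ mu); last by move=> x Ox; rewrite (is_Ckc_notin zc Ox).
move=> <-; rewrite [RHS]integral_mkcond; apply: eq_integral => x _.
rewrite !patchE; case: ifP => _; last by rewrite !mul0r subr0.
congr EFin; move: (expR (u x)) (u x) (laplacian zeta x) (zeta x) => a b c e.
by ring.
Qed.

End weak_solution_identity.

(** * The capacity estimate *)

Section exponential_duality.
Context {R : realType}.
Implicit Types a t : R.

(** [Pstar] is the convex conjugate of [e^|s| - |s| - 1]. The inequality is [1 + x <= expR x] at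
    [x = a - ln (|t| + 1)], multiplied by [|t| + 1]. *)
Lemma Pstar_Young a t : 1 + a + a * `|t| <= expR a + Pstar t.
Proof.
rewrite /Pstar; set b := `|t|.
have b0 : 0 <= b by exact: normr_ge0.
have s0 : 0 < b + 1 by rewrite ltr_wpDl.
have h : (b + 1) * (1 + (a - ln (b + 1))) <= expR a.
  have -> : expR a = (b + 1) * expR (a - ln (b + 1)).
    by rewrite -{1}(lnK s0) -expRD addrC subrK.
  by rewrite ler_wpM2l ?(ltW s0)// expR_ge1Dx.
move: h; move: (ln (b + 1)) (expR a) => l e h; nra.
Qed.

Lemma Pstar_ge0 t : 0 <= Pstar t.
Proof. by have := Pstar_Young 0 t; rewrite expR0 mul0r !addr0 lerDl. Qed.

Lemma measurable_Pstar : measurable_fun [set: R] (@Pstar R).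
Proof.
have mn : measurable_fun [set: R] (fun t : R => `|t|) by exact: measurableT_comp.
have m1 : measurable_fun [set: R] (fun t : R => `|t| + 1) by exact: measurable_funD.
apply: measurable_funB => //; apply: measurable_funM => //.
exact: (measurableT_comp (@measurable_ln R) m1).
Qed.

Lemma sqr_le_expR a : 0 <= a -> a ^+ 2 <= 4 * expR a.
Proof.
move=> a0; have h : 1 + a / 2 <= expR (a / 2) by exact: expR_ge1Dx.
rewrite [a in expR a]splitr expRD.
move: h; move: (expR (a / 2)) => e h.
have e0 : 0 <= e by rewrite (le_trans _ h)// addr_ge0// divr_ge0.
nra.
Qed.

(** Young's inequality rescaled to the gauge norm: when [k] is admissible for that norm, the [Pstar]
    term has integral at most 1, and the factor [k] in front is what tends to 0. *)
Lemma norm_mul_le_Pstar a d (k : R) : 0 < k -> 0 <= a ->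
  a * `|d| <= k * (expR a + Pstar (d / k)).
Proof.
move=> k0 a0; have -> : a * `|d| = k * (a * `|d / k|).
  by rewrite normrM normfV (gtr0_norm k0); field; rewrite gt_eqF.
rewrite ler_wpM2l ?(ltW k0)//; apply: le_trans (Pstar_Young a (d / k)).
by rewrite lerDr addr_ge0.
Qed.

End exponential_duality.

(** * Energy identities *)

Section energy.
Context {R : realType} {N : nat}.
Implicit Types (eta chi : 'rV[R]_N -> R) (Omega : set 'rV[R]_N).
Local Notation leb := (lebesgue_rV R N).
Local Notation intg f := (leb.-integrable [set: 'rV[R]_N] (EFin \o f)).

Lemma laplacian_cst (c : R) (x : 'rV[R]_N) : laplacian (fun=> c) x = 0.
Proof.
have p (d : R) i : partial i (fun _ : 'rV[R]_N => d) = (fun=> 0).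
  by apply/funext => y; apply: partial_val; exact: is_derive_cst.
by rewrite /laplacian big1// => i _; rewrite !p.
Qed.

Lemma Rintegral_laplacian eta : is_Ck 2 setT eta -> bounded_support eta ->
  \int[leb]_x laplacian eta x = 0.
Proof.
move=> eta2 beta.
have e1 : \int[leb]_x (1 * laplacian eta x) = \int[leb]_x laplacian eta x.
  by apply: eq_Rintegral => x _; rewrite mul1r.
have e2 : \int[leb]_x (eta x * laplacian (fun=> 1) x) = 0.
  transitivity (\int[leb]_x (0 : R)); last by rewrite /Rintegral integral0.
  by apply: eq_Rintegral => x _; rewrite laplacian_cst mulr0.
exact: (etrans (esym e1) (etrans (Green (is_Ck_cst 2 1) eta2 beta) e2)).
Qed.

Lemma grad_sqr_intg eta : is_Ck 2 setT eta -> bounded_support eta ->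
  intg (fun x => \sum_(i < N) partial i eta x ^+ 2).
Proof.
move=> eta2 beta; apply: intg_sum => i.
have pc := is_Ck_continuous (is_Ck_partial i eta2).
have pb := bounded_support_partial i beta.
exact: (bounded_support_intg (continuousM_rV pc pc) (bounded_supportM _ pb)).
Qed.

(** The Laplacian of [eta ^ 2], which is [2 * (eta * Delta eta + |grad eta| ^ 2)], has integral
    0. *)
Lemma Dirichlet_energy eta : is_Ck 2 setT eta -> bounded_support eta ->
  \int[leb]_x (\sum_(i < N) partial i eta x ^+ 2) =
  - \int[leb]_x (eta x * laplacian eta x).
Proof.
move=> eta2 beta; have Qi := grad_sqr_intg eta2 beta.
have Li := intg_laplacianM (is_Ck_continuous eta2) eta2 beta.
have := Rintegral_laplacian (is_CkM eta2 eta2) (bounded_supportM _ beta).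
rewrite (@eq_Rintegral _ _ _ leb setT (fun x => 2 * (eta x * laplacian eta x +
  \sum_(i < N) partial i eta x ^+ 2))); last first.
  move=> x _; rewrite (laplacianM x eta2 eta2).
  have -> : \sum_(i < N) partial i eta x * partial i eta x =
    \sum_(i < N) partial i eta x ^+ 2 by apply: eq_bigr => i _; rewrite expr2.
  by move: (\sum_(i < N) _) (laplacian eta x) (eta x) => a b c; ring.
rewrite (RintegralZl _ measurableT (intgD Li Qi)) (RintegralD measurableT Li Qi).
by move=> /eqP; rewrite mulf_eq0 pnatr_eq0/= addrC addr_eq0 => /eqP.
Qed.

Lemma laplacian_coord_sqr (j : 'I_N) (x : 'rV[R]_N) :
  laplacian (fun y : 'rV[R]_N => y ord0 j * y ord0 j) x = 2.
Proof.
have c2 := is_Ck_coord (R := R) 2 j.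
have p i : partial i (fun y : 'rV[R]_N => y ord0 j) = (fun=> (j == i)%:R).
  by apply/funext => y; apply: partial_val; exact: is_derive_coord.
have L0 : laplacian (fun y : 'rV[R]_N => y ord0 j) x = 0.
  rewrite /laplacian big1// => i _; rewrite p.
  by apply: partial_val; exact: is_derive_cst.
rewrite (laplacianM x c2 c2) L0 !mulr0 add0r addr0.
rewrite (bigD1 j)//= big1 => [|i ij]; last by rewrite !p eq_sym (negbTE ij) mulr0.
by rewrite !p eqxx mulr1 addr0 mulr1.
Qed.

(** Green's formula against [x_j ^ 2], whose Laplacian is 2. The choice of a coordinate [j] is where
    positive dimension enters. *)
Lemma double_Rintegral (j : 'I_N) eta : is_Ck 2 setT eta -> bounded_support eta ->
  2 * \int[leb]_x eta x = \int[leb]_x (x ord0 j * x ord0 j * laplacian eta x).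
Proof.
move=> eta2 beta; have c2 := is_Ck_coord (R := R) 2 j.
rewrite (Green (is_CkM c2 c2) eta2 beta).
rewrite -(RintegralZl _ measurableT (bounded_support_intg (is_Ck_continuous eta2) beta)).
by apply: eq_Rintegral => x _; rewrite laplacian_coord_sqr mulrC.
Qed.

End energy.

(** * The estimate for one capacity test function *)

Section small_test_function.
Context {R : realType} {N : nat}.
Implicit Types (eta chi a g H : 'rV[R]_N -> R) (Omega : set 'rV[R]_N).
Local Notation leb := (lebesgue_rV R N).
Local Notation intg f := (leb.-integrable [set: 'rV[R]_N] (EFin \o f)).

(* The first order term [2 a grad chi . grad eta] of [a Delta (eta chi)] is
   split by AM-GM with the weight [dl]. *)
Lemma product_pointwise_bound (a g H M kp dl C e c Le Lc P S Q X : R) :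
  0 < kp -> 0 < dl -> 0 <= C ->
  `|a| <= H -> `|g| <= H -> a ^+ 2 <= 4 * H -> `|a| * `|Le| <= kp * (H + P) ->
  0 <= e <= 1 -> 0 <= c -> c <= C -> `|Lc| <= C -> 0 <= S <= C -> 0 <= Q ->
  a * X <= dl * (a ^+ 2 * S) + dl^-1 * Q ->
  a * (e * Lc + X + c * Le) - g * (e * c) <=
    C * kp * (H + P) + 4 * dl * C * H + dl^-1 * Q +
    2 * C * (M * e + Num.max (`|H| - M) 0).
Proof.
move=> kp0 dl0 C0 aH gH a2 aLe /andP[e0 e1] c0 cC LcC /andP[S0 SC] Q0 aX.
have H0 : 0 <= H by exact: le_trans aH.
(* Only the integral of [eta] is known to be small, while [H] is unbounded: [H] is cut at level [M],
   and [e <= 1] bounds the excess. *)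
have T1 : H * e <= M * e + Num.max (`|H| - M) 0.
  rewrite (ger0_norm H0).
  have T0 : 0 <= Num.max (H - M) 0 by rewrite le_max lexx orbT.
  have T2 : H - M <= Num.max (H - M) 0 by rewrite le_max lexx.
  rewrite -lerBlDl -mulrBl; apply: (@le_trans _ _ (Num.max (H - M) 0 * e)).
    by rewrite ler_wpM2r.
  by rewrite ler_piMr.
have h1 : a * (c * Le) <= C * kp * (H + P).
  rewrite -mulrA mulrCA; apply: (@le_trans _ _ (c * (`|a| * `|Le|))).
    by rewrite ler_wpM2l// -normrM ler_norm.
  by rewrite ler_pM// mulr_ge0.
have h2 : a * (e * Lc) <= C * (H * e).
  have -> : C * (H * e) = e * (H * C) by ring.
  by rewrite mulrCA ler_wpM2l// (le_trans (ler_norm _))// normrM ler_pM.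
have h3 : - (g * (e * c)) <= C * (H * e).
  have -> : C * (H * e) = H * (e * C) by ring.
  rewrite -mulNr; apply: (@le_trans _ _ (H * (e * c))); last by rewrite ler_wpM2l// ler_wpM2l.
  by rewrite ler_wpM2r ?mulr_ge0// (le_trans (ler_norm _))// normrN.
have h4 : dl * (a ^+ 2 * S) <= 4 * dl * C * H.
  have -> : 4 * dl * C * H = dl * (4 * H * C) by ring.
  by rewrite ler_wpM2l ?(ltW dl0)// ler_pM// sqr_ge0.
have h5 : C * (H * e) <= C * (M * e + Num.max (`|H| - M) 0) by rewrite ler_wpM2l.
have -> : a * (e * Lc + X + c * Le) - g * (e * c) =
  a * (c * Le) + a * X + (a * (e * Lc) + - (g * (e * c))) by ring.
have -> : 2 * C * (M * e + Num.max (`|H| - M) 0) =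
  C * (M * e + Num.max (`|H| - M) 0) + C * (M * e + Num.max (`|H| - M) 0) by ring.
move: h1 h2 h3 h4 h5 aX.
move: (C * (M * e + _)) (C * (H * e)) (g * (e * c)) (a * (e * Lc)) => y1 y2 y3 y4.
move: (dl * (a ^+ 2 * S)) (4 * dl * C * H) (dl^-1 * Q) => y5 y6 y7.
move: (a * (c * Le)) (C * kp * (H + P)) (a * X) => y8 y9 y10.
lra.
Qed.

Lemma AM_GM_weighted (dl x y : R) : 0 < dl ->
  2 * x * y <= dl * x ^+ 2 + dl^-1 * y ^+ 2.
Proof.
move=> dl0; have h : 0 <= dl * (x - dl^-1 * y) ^+ 2 by rewrite mulr_ge0 ?sqr_ge0 ?ltW.
rewrite -subr_ge0; suff -> : dl * x ^+ 2 + dl^-1 * y ^+ 2 - 2 * x * y =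
  dl * (x - dl^-1 * y) ^+ 2 by [].
by field; rewrite gt_eqF.
Qed.

(** The three terms on the right are made small in different ways: the last by [M], the middle one
    by [dl], and the first by [kp] alone, whose cofactor does not depend on [eta]. Everything about
    [eta] is reduced to the integral of [|laplacian eta|], at most [kp * (J + 1)]. *)
Lemma small_test_bound (j : 'I_N) Omega a g H chi eta (M kp dl C B : R) :
  is_Ckc 2 Omega eta -> (forall x, 0 <= eta x <= 1) ->
  is_Ckc 2 Omega chi -> (forall x, 0 <= chi x) -> (forall x, chi x <= C) ->
  (forall x, `|laplacian chi x| <= C) ->
  (forall x, \sum_(i < N) partial i chi x ^+ 2 <= C) ->
  0 <= M -> 0 < kp -> 0 < dl -> 0 <= C ->
  intg a -> intg g -> intg H -> (forall x, 0 <= H x) ->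
  (forall x, Omega x -> `|x| <= B) ->
  (forall x, Omega x -> expR `|a x| <= H x) -> (forall x, Omega x -> expR 1 <= H x) ->
  (forall x, Omega x -> `|g x| <= H x) ->
  intg (fun x => Pstar (laplacian eta x / kp)) ->
  \int[leb]_x Pstar (laplacian eta x / kp) <= 1 ->
  \int[leb]_x (a x * laplacian (fun y => eta y * chi y) x) -
  \int[leb]_x (g x * (eta x * chi x)) <=
  kp * ((\int[leb]_x H x + 1) * (C + dl^-1 + C * M * B ^+ 2)) +
  4 * dl * C * \int[leb]_x H x +
  2 * C * \int[leb]_x Num.max (`|H x| - M) 0.
Proof.
move=> etac eta01 chic chi0 chiC LchiC SC M0 kp0 dl0 C0 ai gi Hi H0 OB aH eH gH Pi P1.
have beta := is_Ckc_bounded_support etac; have bchi := is_Ckc_bounded_support chic.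
have [eta2 _ _] := etac; have [chi2 _ _] := chic.
have ceta := is_Ck_continuous eta2; have cLeta := is_C0_laplacian eta2.
have bLeta := bounded_support_laplacian beta.
have Qi := grad_sqr_intg eta2 beta.
have etai := bounded_support_intg ceta beta.
have Letai := bounded_support_intg cLeta bLeta.
set J := \int[leb]_x H x; set P := fun x => Pstar (laplacian eta x / kp).
pose Q x := \sum_(i < N) partial i eta x ^+ 2.
pose T x := Num.max (`|H x| - M) 0.
have J0 : 0 <= J by apply: Rintegral_ge0.
have mH := intg_measurable Hi.
have Ti : intg T.
  apply: (@intg_le _ _ _ leb _ (fun x => `|H x|)).
  - apply: measurable_maxr => //; apply: measurable_funB => //.
    exact: measurableT_comp.
  - exact: intg_norm.
  - move=> x; rewrite ger0_norm ?le_max ?lexx ?orbT// ge_max normr_ge0 andbT.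
    by rewrite lerBlDr lerDl.
have HPi : intg (fun x => H x + P x) by exact: intgD.
have IHP : \int[leb]_x (H x + P x) <= J + 1.
  by rewrite (RintegralD measurableT Hi Pi) lerD2l.
(* Young's inequality with first factor 1, which is the reason for the hypothesis
   [expR 1 <= H x]. *)
have absL x : `|laplacian eta x| <= kp * (H x + P x).
  have [Ox|Ox] := pselect (Omega x); last first.
    rewrite (is_Ckc_laplacian_notin etac Ox) normr0 mulr_ge0 ?(ltW kp0)//.
    by rewrite addr_ge0// Pstar_ge0.
  rewrite -[X in X <= _]mul1r; apply: (le_trans (norm_mul_le_Pstar _ kp0 ler01)).
  by rewrite ler_wpM2l ?(ltW kp0)// lerD2r eH.
have IL : \int[leb]_x `|laplacian eta x| <= kp * (J + 1).
  apply: (@le_trans _ _ (\int[leb]_x (kp * (H x + P x)))).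
    apply: (le_Rintegral measurableT (intg_norm Letai) (intgZ _ HPi)) => x _.
    exact: absL.
  by rewrite (RintegralZl _ measurableT HPi) ler_wpM2l// ltW.
have IQ : \int[leb]_x Q x <= kp * (J + 1).
  rewrite (Dirichlet_energy eta2 beta); apply: le_trans IL.
  have eLi := intg_laplacianM ceta eta2 beta.
  rewrite -mulN1r -(RintegralZl _ measurableT eLi).
  apply: (le_Rintegral measurableT (intgZ _ eLi) (intg_norm Letai)) => x _.
  rewrite mulN1r (le_trans (ler_norm _))// normrN normrM ler_piMl//.
  by have /andP[e0 e1] := eta01 x; rewrite ger0_norm.
have Ieta : 2 * \int[leb]_x eta x <= B ^+ 2 * (kp * (J + 1)).
  rewrite (double_Rintegral j eta2 beta).
  have ci := is_Ck_continuous (is_Ck_coord (R := R) (N := N) 0 j).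
  have xLi := intg_laplacianM (continuousM_rV ci ci) eta2 beta.
  apply: (@le_trans _ _ (\int[leb]_x (B ^+ 2 * `|laplacian eta x|))).
    apply: (le_Rintegral measurableT xLi (intgZ _ (intg_norm Letai))) => x _.
    have [Ox|Ox] := pselect (Omega x); last first.
      by rewrite (is_Ckc_laplacian_notin etac Ox) normr0 !mulr0.
    rewrite (le_trans (ler_norm _))// normrM ler_wpM2r// normrM -expr2.
    have B0 : 0 <= B by rewrite (le_trans _ (OB x Ox)).
    by rewrite ler_pXn2r ?nnegrE//; exact: ((le_rV_norm x B0).2 (OB x Ox)).
  by rewrite (RintegralZl _ measurableT (intg_norm Letai)) ler_wpM2l// sqr_ge0.
pose F x := C * kp * (H x + P x) + 4 * dl * C * H x + dl^-1 * Q x +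
  2 * C * (M * eta x + T x).
have i1 := intgZ (C * kp) HPi; have i2 := intgZ (4 * dl * C) Hi.
have i3 := intgZ dl^-1 Qi; have i4 := intgD (intgZ M etai) Ti.
have i5 := intgZ (2 * C) i4.
have Fi : intg F := intgD (intgD (intgD i1 i2) i3) i5.
have ec2 := is_CkM eta2 chi2.
have bec := bounded_supportM chi beta.
have [K1 _ LK1] := bounded_support_bounded (is_C0_laplacian ec2) (bounded_support_laplacian bec).
have [K2 _ LK2] := bounded_support_bounded (is_Ck_continuous ec2) bec.
have aLi : intg (fun x => a x * laplacian (fun y => eta y * chi y) x).
  exact: (intgM_bounded ai (continuous_measurable_rV (is_C0_laplacian ec2)) LK1).
have gei : intg (fun x => g x * (eta x * chi x)).
  exact: (intgM_bounded gi (continuous_measurable_rV (is_Ck_continuous ec2)) LK2).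
rewrite -(RintegralB measurableT aLi gei).
apply: (@le_trans _ _ (\int[leb]_x F x)).
  apply: (le_Rintegral measurableT (intgB aLi gei) Fi) => x _.
  have Q0 : 0 <= Q x by apply: sumr_ge0 => i _; exact: sqr_ge0.
  have S0 : 0 <= \sum_(i < N) partial i chi x ^+ 2.
    by apply: sumr_ge0 => i _; exact: sqr_ge0.
  have T0 : 0 <= T x by rewrite le_max lexx orbT.
  have /andP[e0 e1] := eta01 x.
  (* The lower bounds on [H] hold on [Omega] only; elsewhere the integrand on the left is 0 and [F]
     is nonnegative. *)
  have [Ox|Ox] := pselect (Omega x); last first.
    have ecc : is_Ckc 2 Omega (fun y => eta y * chi y).
      by apply: (is_Ckc_sub ec2 _ etac) => y ->; rewrite mul0r.
    rewrite (is_Ckc_laplacian_notin ecc Ox) (is_Ckc_notin ecc Ox) !mulr0 subr0.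
    have HP0 : 0 <= H x + P x by rewrite addr_ge0// Pstar_ge0.
    apply: addr_ge0; [apply: addr_ge0; [apply: addr_ge0|]|].
    - by rewrite mulr_ge0// mulr_ge0// ltW.
    - by rewrite mulr_ge0// mulr_ge0// mulr_ge0// ltW.
    - by rewrite mulr_ge0// invr_ge0 ltW.
    - by rewrite mulr_ge0 ?mulr_ge0// addr_ge0// mulr_ge0.
  have aH' : `|a x| <= H x.
    by rewrite (le_trans _ (aH x Ox))// (le_trans _ (expR_ge1Dx _))// lerDr.
  rewrite (laplacianM x eta2 chi2).
  apply: (@product_pointwise_bound _ _ _ _ _ _ _ _ _ _ _ (P x)
    (\sum_(i < N) partial i chi x ^+ 2) (Q x)) => //.
  - exact: gH.
  - rewrite -real_normK ?num_real// (le_trans (sqr_le_expR (normr_ge0 _)))//.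
    by rewrite ler_wpM2l// aH.
  - apply: (le_trans (norm_mul_le_Pstar _ kp0 (normr_ge0 _))).
    by rewrite ler_wpM2l ?(ltW kp0)// lerD2r aH.
  - by rewrite S0 SC.
  - rewrite /Q !mulr_sumr -big_split/=; apply: ler_sum => i _.
    move: (partial i eta x) (partial i chi x) => p q.
    have := AM_GM_weighted (a x * q) p dl0.
    by rewrite exprMn; apply: le_trans; rewrite le_eqVlt; apply/orP; left; apply/eqP; ring.
rewrite /F (RintegralD measurableT (intgD (intgD i1 i2) i3) i5).
rewrite (RintegralD measurableT (intgD i1 i2) i3) (RintegralD measurableT i1 i2).
rewrite (RintegralZl _ measurableT HPi) (RintegralZl _ measurableT Hi).
rewrite (RintegralZl _ measurableT Qi) (RintegralZl _ measurableT i4).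
rewrite (RintegralD measurableT (intgZ M etai) Ti) (RintegralZl _ measurableT etai).
rewrite -/J -/(Q _).
have b1 : C * kp * \int[leb]_x (H x + P x) <= C * kp * (J + 1).
  by rewrite ler_wpM2l// mulr_ge0// ltW.
have b2 : dl^-1 * \int[leb]_x Q x <= dl^-1 * (kp * (J + 1)).
  by rewrite ler_wpM2l// invr_ge0 ltW.
have b3 : C * M * (2 * \int[leb]_x eta x) <= C * M * (B ^+ 2 * (kp * (J + 1))).
  by rewrite ler_wpM2l// mulr_ge0.
move: b1 b2 b3; rewrite /T.
move: (\int[leb]_x (H x + P x)) (\int[leb]_x Q x) (\int[leb]_x eta x) => y1 y2 y3.
move: (\int[leb]_x Num.max (`|H x| - M) 0) dl^-1 => y4 dl' b1 b2 b3.
have -> : C * kp * y1 + 4 * dl * C * J + dl' * y2 + 2 * C * (M * y3 + y4) =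
  C * kp * y1 + dl' * y2 + C * M * (2 * y3) + 4 * dl * C * J + 2 * C * y4 by ring.
have -> : kp * ((J + 1) * (C + dl' + C * M * B ^+ 2)) =
  C * kp * (J + 1) + dl' * (kp * (J + 1)) + C * M * (B ^+ 2 * (kp * (J + 1))) by ring.
by do 2 apply: lerD => //; apply: lerD => //; apply: lerD.
Qed.

End small_test_function.

(** * Compact sets of zero capacity are null *)

Section zero_capacity.
Context {R : realType} {N : nat}.
Implicit Types (eta chi u : 'rV[R]_N -> R) (Omega K : set 'rV[R]_N).
Local Notation leb := (lebesgue_rV R N).
Local Notation intg f := (leb.-integrable [set: 'rV[R]_N] (EFin \o f)).

Lemma zero_cap_test Omega K (kp0 : R) : cap_LlnL Omega K = 0%E -> 0 < kp0 ->
  exists eta kp, [/\ is_Ckc 2 Omega eta, (forall x, 0 <= eta x <= 1),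
    (forall x, K x -> eta x = 1), 0 < kp < kp0 &
    (\int[leb]_(x in Omega) (Pstar (laplacian eta x / kp))%:E <= 1)%E].
Proof.
move=> cap0 kp00.
have : (cap_LlnL Omega K < kp0%:E)%E by rewrite cap0 lte_fin.
move=> /ereal_inf_lt[_ [eta [etac eta01 Keta] <-]] /ereal_inf_lt[_ [kp [kp_gt0 int1] <-]].
rewrite lte_fin => kpkp0; exists eta, kp; split=> //; last by rewrite kp_gt0.
by move=> x /Keta /interior_subset.
Qed.

Lemma Pstar_laplacian_intg Omega eta (kp : R) : is_Ckc 2 Omega eta ->
  (\int[leb]_(x in Omega) (Pstar (laplacian eta x / kp))%:E <= 1)%E ->
  intg (fun x => Pstar (laplacian eta x / kp)) /\
  \int[leb]_x Pstar (laplacian eta x / kp) <= 1.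
Proof.
move=> etac.
have [eta2 _ _] := etac.
have mL := continuous_measurable_rV (is_C0_laplacian eta2).
have mP : measurable_fun setT (fun x => Pstar (laplacian eta x / kp)).
  apply: (measurableT_comp (@measurable_Pstar R)).
  by apply: measurable_funM => //; exact: measurable_cst.
rewrite (@integral_support _ _ leb Omega); last first.
  move=> x Ox; rewrite (is_Ckc_laplacian_notin etac Ox) mul0r.
  by rewrite /Pstar normr0 add0r ln1 mulr0 subr0.
move=> int1.
have Pi : intg (fun x => Pstar (laplacian eta x / kp)).
  apply/integrableP; split; first exact/measurable_EFinP.
  under eq_integral do rewrite gee0_abs ?lee_fin ?Pstar_ge0//.
  by rewrite (le_lt_trans int1)// ltry.
by split => //; rewrite -lee_fin (EFin_Rintegral Pi).
Qed.

Lemma bounded_intg_finite (mu : {finite_measure set 'rV[R]_N -> \bar R})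
    (f : 'rV[R]_N -> R) (C : R) : measurable_fun setT f -> (forall x, `|f x| <= C) ->
  mu.-integrable setT (EFin \o f).
Proof.
move=> mf fC; apply: (@intg_le _ _ _ mu _ (cst C)) => //.
exact: finite_measure_integrable_cst.
Qed.

Lemma zero_cap_compact_null (j : 'I_N) Omega
    (mu : {finite_measure set 'rV[R]_N -> \bar R}) u K :
  open Omega -> bounded_set Omega -> weak_solution Omega mu u ->
  compact K -> K `<=` Omega -> cap_LlnL Omega K = 0%E -> mu K = 0%E.
Proof.
move=> oO bO sol cK KO cap0.
have [u1 eu1 _] := sol.
have mK := compact_measurable_rV cK.
pose w := (fun x => - u x) \_ Omega; pose g := (fun x => 1 - expR (u x)) \_ Omega.
have wE x : Omega x -> w x = - u x by move=> Ox; rewrite /w patchE mem_set.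
have gE x : Omega x -> g x = 1 - expR (u x) by move=> Ox; rewrite /g patchE mem_set.
have w0 x : ~ Omega x -> w x = 0 by move=> Ox; rewrite /w patchE memNset.
have g0 x : ~ Omega x -> g x = 0 by move=> Ox; rewrite /g patchE memNset.
have wi : intg w.
  have := intgN (intg_restrict oO u1); apply: eq_integrable => // x _ /=.
  by rewrite /w !patchE; case: ifP => // _; rewrite oppr0.
have gi : intg g.
  have := intgB (intg_restrict_cst 1 oO bO) (intg_restrict oO eu1).
  apply: eq_integrable => // x _ /=.
  by rewrite /g !patchE; case: ifP => // _; rewrite subr0.
have ident zeta : is_Ckc 2 Omega zeta ->
    \int[leb]_x (w x * laplacian zeta x) - \int[leb]_x (g x * zeta x) = \int[mu]_x zeta x.
  exact: weak_solution_identity.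
have [B0 [_ OB0]] := bO; pose B := B0 + 1.
have OB x : Omega x -> `|x| <= B by move=> Ox; apply: (OB0 B) => //; rewrite ltrDl.
have out x : B < `|x| -> ~ Omega x by move=> Bx /OB; rewrite leNgt Bx.
have [chi [chic chi0 chiK]] := cutoff_exists oO cK KO.
have bchi := is_Ckc_bounded_support chic; have [chi2 _ _] := chic.
have cchi := is_Ck_continuous chi2; have cLchi := is_C0_laplacian chi2.
have [C1 C10 chiC1] := bounded_support_bounded cchi bchi.
have [C2 C20 LC2] := bounded_support_bounded cLchi (bounded_support_laplacian bchi).
have [C3 C30 SC3] : exists2 C3 : R, 0 <= C3 &
    forall x, `|\sum_(i < N) partial i chi x ^+ 2| <= C3.
  apply: bounded_support_bounded.
    apply: (@is_Ck_continuous _ _ 0); apply: is_Ck_sum => i.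
    under eq_fun do rewrite expr2.
    by apply: is_CkM; exact: (is_CkS (is_Ck_partial i chi2)).
  apply: bounded_support_sum => i; under eq_fun do rewrite expr2.
  exact: (bounded_supportM _ (bounded_support_partial i bchi)).
pose C := C1 + C2 + C3.
have C0 : 0 <= C by rewrite !addr_ge0.
have C1C : C1 <= C by rewrite /C -addrA lerDl addr_ge0.
have C2C : C2 <= C by rewrite /C addrAC lerDr addr_ge0.
have C3C : C3 <= C by rewrite /C lerDr addr_ge0.
(* The estimates below add up to [7 * C + 1]: [C] from [Ic], 1 from [kp * Z], and [4 * C], [2 * C]
   from the two other terms of [step5]. The count is rounded up to [8 * C + 1]. *)
suff h eps : 0 < eps -> fine (mu K) <= (8 * C + 1) * eps.
  have muK0 : fine (mu K) <= 0.
    apply/ler_addgt0Pl => eps eps0; rewrite addr0.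
    have C81 : 0 < 8 * C + 1 by rewrite ltr_wpDl// mulr_ge0.
    by have := h _ (divr_gt0 eps0 C81); rewrite mulrCA divff ?mulr1// gt_eqF.
  have muKfin : mu K \is a fin_num by exact: fin_num_measure.
  apply/eqP; rewrite eq_le measure_ge0 andbT -(fineK muKfin) lee_fin//.
move=> eps0.
have [k k0 tailk] := intg_tail wi eps0.
pose a x := w x - smooth_pos (w x - k).
(* A single integrable majorant of [e^|a|], of [e] and of [|g|] on [Omega]. Where [w < 0], [a = w]
   and [e^|a| = e^u]; where [0 <= w <= k], [|a| <= k]; and where [w > k], [k <= a <= k + 2] by
   [smooth_pos_bounds]. *)
pose H := (fun x => expR (u x)) \_ Omega \+ cst (expR (k + 2)) \_ Omega.
have HE x : Omega x -> H x = expR (u x) + expR (k + 2).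
  by move=> Ox; rewrite /H/= !patchE mem_set.
have H0 x : 0 <= H x.
  rewrite /H/= !patchE; case: ifP => _; last by rewrite addr0.
  by rewrite addr_ge0// expR_ge0.
have Hi : intg H := intgD (intg_restrict oO eu1) (intg_restrict_cst (expR (k + 2)) oO bO).
have spb t := smooth_pos_bounds (R := R) t.
have aH x : Omega x -> expR `|a x| <= H x.
  move=> Ox; rewrite HE// /a.
  have := wE x Ox; move: (w x) => W WE.
  have /andP[s1 s2] := spb (W - k).
  have [Wk|Wk] := leP W k.
    rewrite smooth_pos_le0 ?subr_le0// subr0.
    have [W0|W0] := leP 0 W; last by rewrite (ltr0_norm W0) WE opprK lerDl expR_ge0.
    apply: (@le_trans _ _ (expR (k + 2))); last by rewrite lerDr expR_ge0.
    by rewrite ler_expR (ger0_norm W0) ler_wpDr.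
  rewrite max_l ?subr_ge0 ?(ltW Wk)// in s1 s2.
  have sk : k <= W - smooth_pos (W - k) <= k + 2 by apply/andP; split; lra.
  have /andP[sk1 sk2] := sk.
  apply: (@le_trans _ _ (expR (k + 2))); last by rewrite lerDr expR_ge0.
  by rewrite ler_expR ger0_norm// (le_trans k0).
have eH x : Omega x -> expR 1 <= H x.
  move=> Ox; rewrite HE//; apply: (@le_trans _ _ (expR (k + 2))); last first.
    by rewrite lerDr expR_ge0.
  by rewrite ler_expR; lra.
have gH x : Omega x -> `|g x| <= H x.
  move=> Ox; rewrite gE// HE// (le_trans (ler_normB _ _))// normr1.
  rewrite (ger0_norm (expR_ge0 _)) addrC lerD2l -[leLHS]expR0 ler_expR; lra.
have csp : continuous (@smooth_pos R).
  by move=> t; exact: (is_derive_derivable_continuous (@is_derive_smooth_pos R t)).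
have Phii : intg (fun x => smooth_pos (w x - k)).
  apply: (@intg_le _ _ _ leb _ (fun x => `|w x|)).
  - apply: measurableT_comp; first exact: continuous_measurable_fun.
    by apply: measurable_funB => //; exact: (intg_measurable wi).
  - exact: intg_norm.
  - move=> x; rewrite ger0_norm ?smooth_pos_ge0//.
    have /andP[s1 _] := spb (w x - k).
    apply: (@le_trans _ _ (Num.max (w x - k) 0)); first by rewrite -subr_ge0.
    by rewrite ge_max normr_ge0 andbT (le_trans _ (ler_norm _))// lerBlDr lerDl.
have ai : intg a := intgB wi Phii.
pose J := \int[leb]_x H x.
have J0 : 0 <= J by apply: Rintegral_ge0.
have J1 : 0 < J + 1 by rewrite ltr_wpDl.
have [M M0 tailM] := intg_tail Hi eps0.
(* This gives [dl * J <= eps]. [Z] gathers the cofactor of [kp] in [small_test_bound]; it is fixed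
   before [eta] is chosen, so [kp < eps / (Z + 1)] can be demanded afterwards. *)
pose dl := eps / (J + 1); have dl0 : 0 < dl by rewrite divr_gt0.
pose Z := (J + 1) * (C + dl^-1 + C * M * B ^+ 2).
have Z0 : 0 <= Z.
  have dl'0 : 0 <= dl^-1 by rewrite invr_ge0 ltW.
  by rewrite mulr_ge0 ?(ltW J1)// !addr_ge0// mulr_ge0 ?sqr_ge0// mulr_ge0.
have Z1 : 0 < Z + 1 by rewrite ltr_wpDl.
have [eta [kp [etac eta01 etaK /andP[kp0 kpZ] int1]]] :=
  zero_cap_test cap0 (divr_gt0 eps0 Z1).
have [Pi P1] := Pstar_laplacian_intg etac int1.
have [eta2 _ _] := etac.
have ec2 := is_CkM eta2 chi2.
have ecc : is_Ckc 2 Omega (fun x => eta x * chi x).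
  by apply: (is_Ckc_sub ec2 _ etac) => y ->; rewrite mul0r.
have bec := is_Ckc_bounded_support ecc.
have step1 : fine (mu K) <= \int[mu]_x (eta x * chi x).
  have eci := bounded_intg_finite mu (continuous_measurable_rV (is_Ck_continuous ec2)).
  have [K2 _ LK2] := bounded_support_bounded (is_Ck_continuous ec2) bec.
  rewrite -lee_fin (EFin_Rintegral (eci _ LK2)) fineK; last exact: fin_num_measure.
  rewrite -[X in (mu X <= _)%E]setIT -integral_indic//.
  apply: ge0_le_integral => //.
  - exact/measurable_EFinP/measurable_indic.
  - by apply/measurable_EFinP; exact: (continuous_measurable_rV (is_Ck_continuous ec2)).
  - move=> x _; rewrite lee_fin indicE; have [Kx|Kx] := boolP (x \in K).
      by move: Kx; rewrite inE => Kx; rewrite etaK// chiK// mul1r.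
    by rewrite mulr_ge0//; have /andP[] := eta01 x.
have [K1 _ LK1] := bounded_support_bounded (is_C0_laplacian ec2)
  (bounded_support_laplacian bec).
have mLec := continuous_measurable_rV (is_C0_laplacian ec2).
have aLi := intgM_bounded ai mLec LK1.
have PLi := intgM_bounded Phii mLec LK1.
have PLchii := intgM_bounded Phii (continuous_measurable_rV cLchi) LC2.
pose Ia := \int[leb]_x (a x * laplacian (fun y => eta y * chi y) x).
pose Ig := \int[leb]_x (g x * (eta x * chi x)).
pose Ip := \int[leb]_x (smooth_pos (w x - k) * laplacian (fun y => eta y * chi y) x).
pose Ic := \int[leb]_x (smooth_pos (w x - k) * laplacian chi x).
have step2 : \int[leb]_x (w x * laplacian (fun y => eta y * chi y) x) = Ia + Ip.
  rewrite /Ia /Ip -(RintegralD measurableT aLi PLi); apply: eq_Rintegral => x _.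
  by rewrite -mulrDl subrK.
(* Kato's inequality is tested with [chi - eta * chi], which is nonnegative because [eta <= 1]. *)
have step3 : Ip <= Ic.
  have psi2 := is_CkB chi2 ec2.
  have psic : is_Ckc 2 Omega (fun x => chi x - eta x * chi x).
    by apply: (is_Ckc_sub psi2 _ chic) => y ->; rewrite mulr0 subr0.
  have psi0 x : 0 <= chi x - eta x * chi x.
    by rewrite subr_ge0 ler_piMl//; have /andP[] := eta01 x.
  have gk x : k < w x -> 0 <= g x.
    have [Ox|Ox] := pselect (Omega x); last by rewrite w0// ltNge k0.
    rewrite wE// gE// => ku; rewrite subr_ge0 -expR0 ler_expR; lra.
  have sub zeta : is_Ckc 2 Omega zeta -> (forall x, 0 <= zeta x) ->
      \int[leb]_x (g x * zeta x) <= \int[leb]_x (w x * laplacian zeta x).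
    move=> zc z0; rewrite -subr_ge0 ident//; exact: Rintegral_ge0.
  have := Kato oO wi gi (fun x Bx => w0 x (out x Bx)) (fun x Bx => g0 x (out x Bx))
    gk sub psic psi0 k0.
  have E : \int[leb]_x (smooth_pos (w x - k) * laplacian (fun x => chi x - eta x * chi x) x)
    = Ic - Ip.
    rewrite /Ic /Ip -(RintegralB measurableT PLchii PLi); apply: eq_Rintegral => x _.
    by rewrite (laplacianB x chi2 ec2) mulrBr.
  by rewrite [X in 0 <= X]E subr_ge0.
(* Here [smooth_pos (w - k) <= (w - k)^+ <= (|w| - k)^+], the tail made small by the choice of
   [k]. *)
have step4 : Ic <= C * eps.
  have Ti : intg (fun x => Num.max (`|w x| - k) 0).
    apply: (@intg_le _ _ _ leb _ (fun x => `|w x|)).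
    - apply: measurable_maxr => //; apply: measurable_funB => //.
      by apply: measurableT_comp => //; exact: (intg_measurable wi).
    - exact: intg_norm.
    - move=> x; rewrite ger0_norm ?le_max ?lexx ?orbT// ge_max normr_ge0 andbT.
      by rewrite lerBlDr lerDl.
  apply: (@le_trans _ _ (\int[leb]_x (C * Num.max (`|w x| - k) 0))); last first.
    by rewrite (RintegralZl _ measurableT Ti) ler_wpM2l.
  apply: (le_Rintegral measurableT PLchii (intgZ _ Ti)) => x _.
  rewrite (le_trans (ler_norm _))// normrM mulrC ler_pM ?(le_trans (LC2 x))//.
  rewrite ger0_norm ?smooth_pos_ge0//.
  have /andP[s1 _] := spb (w x - k).
  apply: (@le_trans _ _ (Num.max (w x - k) 0)); first by rewrite -subr_ge0.
  by rewrite ge_max !le_max lexx orbT andbT lerD2r ler_norm.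
pose IT := \int[leb]_x Num.max (`|H x| - M) 0.
have step5 : Ia - Ig <= kp * Z + 4 * dl * C * J + 2 * C * IT :=
  small_test_bound j etac eta01 chic chi0
  (fun x => le_trans (ler_norm _) (le_trans (chiC1 x) C1C))
  (fun x => le_trans (LC2 x) C2C)
  (fun x => le_trans (ler_norm _) (le_trans (SC3 x) C3C))
  M0 kp0 dl0 C0 ai gi Hi H0 OB aH eH gH Pi P1.
have s5a : kp * Z <= eps.
  apply: (@le_trans _ _ (eps / (Z + 1) * Z)); first by rewrite ler_wpM2r// ltW.
  by rewrite -mulrA ler_piMr ?(ltW eps0)// ler_pdivrMl// mulr1 lerDl.
have s5b : 4 * dl * C * J <= 4 * C * eps.
  have -> : 4 * dl * C * J = 4 * C * (dl * J) by ring.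
  rewrite ler_wpM2l ?mulr_ge0// /dl -mulrA ler_piMr ?(ltW eps0)//.
  by rewrite ler_pdivrMl// mulr1 lerDl.
have s5c : 2 * C * IT <= 2 * C * eps.
  by rewrite ler_wpM2l ?mulr_ge0.
have idn : \int[leb]_x (w x * laplacian (fun y => eta y * chi y) x) - Ig =
  \int[mu]_x (eta x * chi x) := ident _ ecc.
have step6 : fine (mu K) <= Ia + Ip - Ig by rewrite -step2 idn.
have Ce : 0 <= C * eps by rewrite mulr_ge0// ltW.
move: step3 step4 step5 step6 s5a s5b s5c Ce; clear.
move: (fine (mu K)) Ia Ig Ip Ic IT (kp * Z) => m y1 y2 y3 y4 y5 y6.
move: (4 * dl * C * J) => y7; lra.
Qed.

End zero_capacity.

(** * From compact sets to Borel sets *)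

Theorem theoremD (R : realType) (N : nat) (N_gt0 : (0 < N)%N)
    (Omega : set 'rV[R]_N) (Omega_domain : is_domain Omega)
    (Omega_bounded : bounded_set Omega) (Omega_smooth : smooth_boundary Omega)
    (mu : {finite_measure set 'rV[R]_N -> \bar R})
    (mu_Omega : carried_by Omega mu) (mu_good : good_measure Omega mu)
    (E : set 'rV[R]_N) (mE : measurable E) (E_Omega : E `<=` Omega)
    (E_cap0 : zero_cap_LlnL Omega E) :
  mu E = 0%E.
Proof.
have [oO _ _] := Omega_domain; have [u sol] := mu_good.
apply/eqP; rewrite eq_le measure_ge0 andbT; apply/lee_addgt0Pr => eps eps0.
(* The closed set [F] is compact because [E] lies in the bounded set [Omega], so the zero-capacity
   hypothesis applies to it; the rest of [E] is contained in [G] minus [F], of measure at most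
   [eps]. *)
have [F [G [cF oG FE EG GF]]] := measurable_regular mu mE eps0.
have bF : bounded_set F.
  have [B [Br OB]] := Omega_bounded; exists B; split => // t Bt x Fx.
  exact: (OB t Bt x (E_Omega _ (FE _ Fx))).
have cpF : compact F by exact: bounded_closed_compact.
have mF := compact_measurable_rV cpF; have mG := open_measurable_rV oG.
have F0 : mu F = 0%E.
  apply: (zero_cap_compact_null (Ordinal N_gt0) oO Omega_bounded sol cpF).
    exact: subset_trans E_Omega.
  exact: E_cap0.
apply: (@le_trans _ _ (mu (F `|` (G `\` F)))).
  apply: le_measure; rewrite ?inE//.
    by apply: measurableU => //; exact: measurableD.
  by move=> x Ex; have [Fx|Fx] := pselect (F x); [left|right; split => //; exact: EG].
apply: (le_trans (measureU2 _ mF (measurableD mG mF))).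
apply: leeD; last exact: GF.
by rewrite le_eqVlt; apply/orP; left; apply/eqP; exact: F0.
Qed.
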